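(* Let $\mathcal{G}$ be a second countable locally compact abelian group with Haar measure $\mu_{\mathcal{G}}$, let $\pi$ be a dual integrable representation of $\mathcal{G}$ on a separable Hilbert space $\mathcal{H}$, and let $(\theta_i)_{i\in I}\subseteq\mathcal{H}$ be a family of orthogonal generators for $\pi$, with $T\colon\mathcal{H}\to L^2(\hat{\mathcal{G}};l^2(I))$ as defined in the context. Suppose in addition that $\mathcal{G}$ is discrete. For a countable family $\mathscr{A}\subseteq\mathcal{H}$ and constants $0<A\le B<\infty$, the following are equivalent: (i) $E(\mathscr{A})=\{\pi(x)\varphi:x\in\mathcal{G},\varphi\in\mathscr{A}\}$ forms a Riesz basis for $S(\mathscr{A})$ with bounds $A,B$. (ii) For a.e. $\alpha\in\hat{\mathcal{G}}$, $\{T\varphi(\alpha):\varphi\in\mathscr{A}\}$ forms a Riesz sequence in $l^2(I)$ with bounds $A,B$.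
   Context: $\hat{\mathcal{G}}$ is the dual group of $\mathcal{G}$, with Haar measure $\mu_{\hat{\mathcal{G}}}$ dual to $\mu_{\mathcal{G}}$. A representation $\pi$ of $\mathcal{G}$ on $\mathcal{H}$ is a strongly continuous homomorphism into the unitary group of $\mathcal{H}$. It is dual integrable if there is a (necessarily unique) function $[\cdot,\cdot]\colon\mathcal{H}\times\mathcal{H}\to L^1(\hat{\mathcal{G}})$, called the bracket, with $\langle\varphi,\pi(x)\psi\rangle=\int_{\hat{\mathcal{G}}}[\varphi,\psi](\alpha)\overline{\alpha(x)}\,d\mu_{\hat{\mathcal{G}}}(\alpha)$ for all $\varphi,\psi\in\mathcal{H}$ and $x\in\mathcal{G}$. Put $\langle\psi\rangle=\overline{\operatorname{span}}\{\pi(x)\psi:x\in\mathcal{G}\}$. A family $(\theta_i)_{i\in I}\subseteq\mathcal{H}$ is called orthogonal generators for $\pi$ if $\mathcal{H}=\bigoplus_{i\in I}\langle\theta_i\rangle$ (orthogonal direct sum). Let $\Omega_i=\{\alpha\in\hat{\mathcal{G}}:[\theta_i,\theta_i](\alpha)\ne0\}$ and define, for $\varphi\in\mathcal{H}$ and $\alpha\in\hat{\mathcal{G}}$, $$T(\varphi)(\alpha)=\left(\mathbf{1}_{\Omega_i}(\alpha)\cdot\frac{[\varphi,\theta_i](\alpha)}{([\theta_i,\theta_i](\alpha))^{1/2}}\right)_{i\in I}.$$ $S(\mathscr{A})=\overline{\operatorname{span}}\{\pi(x)\varphi:x\in\mathcal{G},\varphi\in\mathscr{A}\}$. A countable family $(u_j)_{j\in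 J}$ of vectors in a Hilbert space is a Riesz sequence with bounds $A,B$ if $A\sum_{j}|c_j|^2\le\|\sum_{j} c_ju_j\|^2\le B\sum_{j}|c_j|^2$ for all $(c_j)_{j\in J}\in l^2(J)$ with only finitely many $c_j\ne0$; it is a Riesz basis for the Hilbert space if in addition it spans a dense subspace. $E(\mathscr{A})$ and $\{T\varphi(\alpha):\varphi\in\mathscr{A}\}$ are regarded as indexed families (with multiplicities).
   Formalization: The Haar measure of the discrete group is taken to be counting measure (mass 1 on points); for c times counting measure the bounds in (ii) become cA, cB, so the equivalence with the same A, B fails. *)

(* Defs.v *)
From HB Require Import structures.
From mathcomp Require Import all_boot all_order all_algebra.
From mathcomp Require Import all_classical all_reals all_analysis.
From mathcomp Require Import complex.

Set Implicit Arguments.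
Unset Strict Implicit.
Unset Printing Implicit Defensive.
Import Order.TTheory GRing.Theory Num.Theory.
Import numFieldNormedType.Exports.
Local Open Scope classical_set_scope.
Local Open Scope ring_scope.

(* [complex R] carries no topology of its own in the library; its regular
   module [R[i]^o] has the topology of the numeric field [R[i]]. *)
Record dual (R : realType) (G : topologicalZmodType) := Dual {
  dual_fun :> G -> R[i]^o;
  dual_continuous : continuous dual_fun;
  dual_morph : forall x y, dual_fun (x + y) = dual_fun x * dual_fun y;
  dual_norm : forall x, `|dual_fun x| = 1 }.

Section DualGroup.
Variables (R : realType) (G : topologicalZmodType).
Local Notation Ghat := (dual R G).
Implicit Types a b c : Ghat.

HB.instance Definition _ := gen_eqMixin Ghat.
HB.instance Definition _ := gen_choiceMixin Ghat.

Lemma dual_ext a b : (forall x, a x = b x) -> a = b.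
Proof.
case: a b => [a ca ma na] [b cb mb nb] /= /funext eab.
by subst b; congr Dual; exact: Prop_irrelevance.
Qed.

Fact dual_one_subproof (x y : G) : (1 : R[i]^o) = 1 * 1.
Proof. by rewrite mulr1. Qed.

Definition dual_one : Ghat :=
  @Dual R G (fun=> 1) (fun x => @cvg_cst _ _ _ _ _)
    dual_one_subproof (fun=> normr1 _).

Section Mul.
Variables a b : Ghat.
Fact dual_mul_continuous : continuous (fun x => a x * b x : R[i]^o).
Proof.
by move=> x; apply: (@cvgM R[i] _ (nbhs x)); exact: dual_continuous.
Qed.
Fact dual_mul_morph x y : a (x + y) * b (x + y) = (a x * b x) * (a y * b y).
Proof. by rewrite !dual_morph mulrACA. Qed.
Fact dual_mul_norm x : `|a x * b x| = 1.
Proof. by rewrite normrM !dual_norm mulr1. Qed.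
Definition dual_mul : Ghat :=
  Dual dual_mul_continuous dual_mul_morph dual_mul_norm.
End Mul.

Section Inv.
Variable a : Ghat.
Fact dual_inv_continuous : continuous (fun x => a (- x)).
Proof.
move=> x; apply: (@continuous_comp _ _ _ (-%R) a x).
  exact: opp_continuous.
exact: dual_continuous.
Qed.
Fact dual_inv_morph x y : a (- (x + y)) = a (- x) * a (- y).
Proof. by rewrite opprD dual_morph. Qed.
Definition dual_inv : Ghat :=
  Dual dual_inv_continuous dual_inv_morph (fun x => dual_norm a (- x)).
End Inv.

Fact dual_mulA : associative dual_mul.
Proof. by move=> a b c; apply: dual_ext => x /=; rewrite mulrA. Qed.
Fact dual_mulC : commutative dual_mul.
Proof. by move=> a b; apply: dual_ext => x /=; rewrite mulrC. Qed.
Fact dual_mul1 : left_id dual_one dual_mul.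
Proof. by move=> a; apply: dual_ext => x /=; rewrite mul1r. Qed.
Fact dual_mulV : left_inverse dual_one dual_inv dual_mul.
Proof.
move=> a; apply: dual_ext => x /=; rewrite -dual_morph addNr.
have a0 : a 0 != 0 by rewrite -normr_eq0 dual_norm oner_neq0.
by apply: (mulfI a0); rewrite -dual_morph addr0 mulr1.
Qed.

(* Pointwise multiplication of characters, written additively. *)
HB.instance Definition _ :=
  GRing.isZmodule.Build Ghat dual_mulA dual_mulC dual_mul1 dual_mulV.

HB.instance Definition _ := Topological.copy Ghat
  (initial_topology (@dual_fun R G : Ghat -> {compact-open, G -> R[i]^o})).

End DualGroup.

Definition borel (T : PreTopologicalZmodule.type) : Type := T.

Section Borel.
Variable T : PreTopologicalZmodule.type.
HB.instance Definition _ := Choice.on (borel T).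
HB.instance Definition _ := isPointed.Build (borel T) (0 : T).
HB.instance Definition _ := Measurable.copy (borel T)
  (g_sigma_algebraType (@open T : set (set (borel T)))).
End Borel.

Section Haar.
Local Open Scope ereal_scope.

(* On a second countable locally compact Hausdorff space every Borel measure
   that is finite on compact sets is regular. *)
Definition is_haar (R : realType) (T : PreTopologicalZmodule.type)
    (mu : {measure set (borel T) -> \bar R}) :=
  [/\ mu setT != 0,
      forall K : set T, compact K -> mu K < +oo &
      forall (x : T) (A : set T), measurable (A : set (borel T)) ->
        mu [set (x + a)%R | a in A] = mu A].

End Haar.

Section ComplexIntegral.
Context d (T : measurableType d) (R : realType).
Variable mu : {measure set T -> \bar R}.
Implicit Type f : T -> R[i].

Definition cintegrable f :=
  mu.-integrable setT (EFin \o (fun t => complex.Re (f t))) /\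
  mu.-integrable setT (EFin \o (fun t => complex.Im (f t))).

Definition cintegral f : R[i] :=
  Complex (Rintegral mu setT (fun t => complex.Re (f t)))
          (Rintegral mu setT (fun t => complex.Im (f t))).

End ComplexIntegral.

Definition sqmod (R : realType) (z : R[i]) : R := complex.Re `|z| ^+ 2.

Section DualMeasure.
Variables (R : realType) (G : topologicalZmodType).
Variables (mu : {measure set (borel G) -> \bar R})
          (muhat : {measure set (borel (dual R G)) -> \bar R}).

Definition fourier (f : borel G -> R[i]) (a : dual R G) : R[i] :=
  cintegral mu (fun x => f x * (a x)^*).

(* The Haar measure [muhat] is dual to [mu] when the Fourier transform is
   isometric from L^1(G) /\ L^2(G) to L^2 of the dual (Plancherel). *)
Definition dual_measure := forall f : borel G -> R[i],
  cintegrable mu f ->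
  (\int[mu]_x (sqmod (f x))%:E < +oo)%E ->
  (\int[muhat]_a (sqmod (fourier f a))%:E = \int[mu]_x (sqmod (f x))%:E)%E.

End DualMeasure.

Section Span.
Context (K : numFieldType) (V : normedModType K).

Definition lspan (X : set V) : set V :=
  [set v | exists n (c : 'I_n -> K) (x : 'I_n -> V),
     (forall k, X (x k)) /\ v = \sum_(k < n) c k *: x k].

Definition cspan (X : set V) : set V := closure (lspan X).

End Span.

Section Riesz.
Context (R : realType).

(* A Hilbert space is given as the set of vectors of finite norm of a vector
   space [V], where [N v] is the squared norm of [v] ([+oo] off the space).
   This covers both an abstract Hilbert space and l^2(I) inside [I -> R[i]]. *)
Definition riesz_sequence (V : lmodType R[i]) (N : V -> \bar R)
    (J : choiceType) (u : J -> V) (A B : R) :=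
  (forall j, (N (u j) < +oo)%E) /\
  forall c : J -> R[i], finite_set [set j | c j != 0] ->
    let c2 := \sum_(j \in [set: J]) sqmod (c j) in
    let v := \sum_(j \in [set: J]) c j *: u j in
    ((A * c2)%:E <= N v <= (B * c2)%:E)%E.

Definition l2_sqnorm (I : choiceType) (v : I -> R[i]) : \bar R :=
  \esum_(i in [set: I]) (sqmod (v i))%:E.

Context (H : completeNormedModType R[i]).

Definition sqnorm (v : H) : \bar R := (complex.Re `|v| ^+ 2)%:E.

(* [S] is a closed subspace. *)
Definition riesz_basis (S : set H) (J : choiceType) (u : J -> H) (A B : R) :=
  [/\ forall j, S (u j), riesz_sequence sqnorm u A B &
      S `<=` cspan (range u)].

End Riesz.

Section Representation.
Context (R : realType) (G : topologicalZmodType).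
Context (H : completeNormedModType R[i]).
Variable ip : {dot H for @Num.conj R[i]}.
Variable pi : G -> {linear H -> H}.

Record unitary_rep : Prop := UnitaryRep {
  rep_isometry : forall x u v, ip (pi x u) (pi x v) = ip u v;
  rep_surj : forall x v, exists u, pi x u = v;
  rep_morph : forall x y v, pi (x + y) v = pi x (pi y v);
  rep_continuous : forall v, continuous (fun x => pi x v) }.

Definition cyclic_space (psi : H) : set H := cspan (range (fun x => pi x psi)).

Definition orthogonal_generators (I : choiceType) (theta : I -> H) :=
  (forall i j, i != j -> forall u v,
     cyclic_space (theta i) u -> cyclic_space (theta j) v -> ip u v = 0) /\
  cspan (\bigcup_i cyclic_space (theta i)) = setT.

Definition orbit_family (J : choiceType) (phi : J -> H) (p : G * J) : H :=
  pi p.1 (phi p.2).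

Definition invariant_span (J : choiceType) (phi : J -> H) : set H :=
  cspan (range (orbit_family phi)).

Variable muhat : {measure set (borel (dual R G)) -> \bar R}.

Definition is_bracket (phi psi : H) (f : borel (dual R G) -> R[i]) :=
  cintegrable muhat f /\
  forall x : G, ip phi (pi x psi) =
    cintegral muhat (fun a => f a * ((a : dual R G) x)^*).

Definition dual_integrable := forall phi psi, exists f, is_bracket phi psi f.

(* A representative of the class in L^1 of the bracket; it depends only on
   that class. *)
Definition bracket (phi psi : H) : borel (dual R G) -> R[i] :=
  xget (fun=> 0) (is_bracket phi psi).

Definition Omega (I : choiceType) (theta : I -> H) (i : I) :
    set (borel (dual R G)) :=
  [set a | bracket (theta i) (theta i) a != 0].

Definition T_map (I : choiceType) (theta : I -> H) (phi : H)
    (a : borel (dual R G)) (i : I) : R[i] :=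
  \1_(Omega theta i) a *
  (bracket phi (theta i) a / sqrtC (bracket (theta i) (theta i) a)).

End Representation.

(* Main.v *)
Require Import Defs.
From HB Require Import structures.
From mathcomp Require Import all_boot all_order all_algebra.
From mathcomp Require Import finmap.
From mathcomp Require Import all_classical all_reals all_analysis.
From mathcomp Require Import complex ring lra measurable_realfun.
Import Order.TTheory GRing.Theory Num.Theory.
Import numFieldNormedType.Exports.
Import HBNNSimple.
Local Open Scope classical_set_scope.
Local Open Scope ring_scope.

Set Implicit Arguments.
Unset Strict Implicit.

(** Since G is countable and discrete, its dual carries a translation invariant
    probability measure for which the characters are orthonormal
    ([trig_parseval]).  Three facts give the equivalence.

    For every nonnegative integrable weight w, trigonometric polynomials
    approximate all bounded measurable functions in L^2(w) ([trig_dense]).  Indeed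
    the functions that can be approximated form an algebra closed under bounded
    limits, iterating one odd cubic polynomial produces signs and hence
    indicators of half planes, and these generate the Borel sets because compact
    subsets of G are finite.  One consequence is that an integrable real h with
    nonnegative integral against |p|^2 for all trigonometric polynomials p is
    nonnegative almost everywhere ([ae_ge0_of_tests]).

    The map T is isometric ([integral_fiber_sqnorm]).  For a vector v and a
    combination w of the orbits of the generators, 2 Re <v, w> - |w|^2 is a sum of
    integrals of 2 Re (b_i conj(m_i)) - |m_i|^2 t_i, where b_i = [v, theta_i],
    t_i = [theta_i, theta_i], and the m_i are the trigonometric polynomials formed
    with the coefficients of w.  The supremum over all w is |v|^2, because the
    orbits span a dense subspace.  By density of trigonometric polynomials the
    supremum may be taken over bounded measurable m_i, and then it is the sum of
    the integrals of |b_i|^2 / t_i, attained in the limit by m_i = b_i / t_i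
    ([parseval]).  Only countably many generators are nonzero, so sum and integral
    can be exchanged.

    A combination of the vectors pi(x) phi_j has as fiber the combination of the
    T phi_j (a) with trigonometric polynomials m_j (a) as coefficients, and the sum
    of the squared coefficients is the integral of the sum of the |m_j|^2.  So
    pointwise Riesz inequalities integrate to those for the orbits
    ([riesz_orbit_of_fibers]).  Conversely, with m_j = d_j p for a fixed vector d
    the inequalities for the orbits say that |p|^2 has nonnegative integrals
    against the differences of the two sides in the fibers; these are therefore
    nonnegative almost everywhere ([ae_riesz_fiber]).  Letting d run through the
    countably many rational vectors and using continuity gives all coefficients
    outside a single null set ([riesz_fibers_of_orbit]). *)

(** * Complex scalars *)

Section ComplexScalars.
Context {R : realType}.
Implicit Types (z y : R[i]) (r : R).

Lemma ReD z y : complex.Re (z + y) = complex.Re z + complex.Re y.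
Proof. by case: z; case: y. Qed.

Lemma ImD z y : complex.Im (z + y) = complex.Im z + complex.Im y.
Proof. by case: z; case: y. Qed.

Lemma ReN z : complex.Re (- z) = - complex.Re z.
Proof. by case: z. Qed.

Lemma ImN z : complex.Im (- z) = - complex.Im z.
Proof. by case: z. Qed.

Lemma ReM z y : complex.Re (z * y) =
  complex.Re z * complex.Re y - complex.Im z * complex.Im y.
Proof. by case: z; case: y. Qed.

Lemma ImM z y : complex.Im (z * y) =
  complex.Re z * complex.Im y + complex.Im z * complex.Re y.
Proof. by case: z; case: y. Qed.

Lemma conjE z : z^* = Complex (complex.Re z) (- complex.Im z).
Proof.
have eJ : z * conjc z = z * z^* by rewrite -sqr_normc normCK.
have [z0|zn0] := eqVneq z 0; last by rewrite -(mulfI zn0 eJ); case: {+}z.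
by rewrite z0 conjC0 /= oppr0.
Qed.

Lemma ReJ z : complex.Re z^* = complex.Re z.
Proof. by rewrite conjE. Qed.

Lemma ImJ z : complex.Im z^* = - complex.Im z.
Proof. by rewrite conjE. Qed.

Definition Re_Im := (ReD, ImD, ReN, ImN, ReM, ImM, ReJ, ImJ).

Lemma complex_eq z y :
  complex.Re z = complex.Re y -> complex.Im z = complex.Im y -> z = y.
Proof. by case: z; case: y => ? ? ? ? /= -> ->. Qed.

Lemma sqmodE z : sqmod z = complex.Re z ^+ 2 + complex.Im z ^+ 2.
Proof. by rewrite /sqmod normc_def /= sqr_sqrtr // addr_ge0 // sqr_ge0. Qed.

Lemma sqmod_ge0 z : 0 <= sqmod z.
Proof. by rewrite sqr_ge0. Qed.

Lemma sqmodM z y : sqmod (z * y) = sqmod z * sqmod y.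
Proof. by rewrite !sqmodE !Re_Im; ring. Qed.

Lemma sqmodN z : sqmod (- z) = sqmod z.
Proof. by rewrite !sqmodE !Re_Im; ring. Qed.

Lemma sqmodJ z : sqmod z^* = sqmod z.
Proof. by rewrite !sqmodE !Re_Im; ring. Qed.

Lemma sqmod0 : sqmod (0 : R[i]) = 0.
Proof. by rewrite sqmodE /= expr0n addr0. Qed.

Lemma sqmod1 : sqmod (1 : R[i]) = 1.
Proof. by rewrite sqmodE /= expr0n addr0 expr1n. Qed.

Lemma sqmod_real r : sqmod (r%:C)%C = r ^+ 2.
Proof. by rewrite sqmodE /= expr0n addr0. Qed.

Lemma sqmod_eq0 z : (sqmod z == 0) = (z == 0).
Proof.
rewrite sqmodE paddr_eq0 ?sqr_ge0// !sqrf_eq0; case: z => a b /=.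
by rewrite eq_complex.
Qed.

Lemma sqmod_norm z : `|z| = 1 -> sqmod z = 1.
Proof. by rewrite /sqmod => ->; rewrite /= expr1n. Qed.

Lemma sqmodV z : sqmod z^-1 = (sqmod z)^-1.
Proof.
have [->|z0] := eqVneq z 0; first by rewrite invr0 sqmod0 invr0.
have s0 : sqmod z != 0 by rewrite sqmod_eq0.
by apply: (mulfI s0); rewrite -sqmodM !divff // sqmod1.
Qed.

Lemma normc_lt_sqmod r z : 0 < r -> (`|z| < (r%:C)%C) = (sqmod z < r ^+ 2).
Proof.
move=> r0; rewrite sqmodE normc_def ltcR -{1}(gtr0_norm r0) -sqrtr_sqr.
by rewrite ltr_sqrt // exprn_gt0.
Qed.

Lemma mulJ z : z * z^* = ((sqmod z)%:C)%C.
Proof. by apply: complex_eq; rewrite ?sqmodE /= !Re_Im /=; ring. Qed.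

(** The two weights balance each other: once the perturbation y has been made
    small compared with e, letting e tend to 0 leaves only the first term. *)
Lemma sqmodD_le (e : R) z y : 0 < e ->
  sqmod (z + y) <= (1 + e) * sqmod z + (1 + e^-1) * sqmod y.
Proof.
move=> e0; rewrite !sqmodE !Re_Im.
have H (a b : R) : (a + b) ^+ 2 <= (1 + e) * a ^+ 2 + (1 + e^-1) * b ^+ 2.
  rewrite -subr_ge0.
  have -> : (1 + e) * a ^+ 2 + (1 + e^-1) * b ^+ 2 - (a + b) ^+ 2 =
            e^-1 * (e * a - b) ^+ 2 by field; rewrite gt_eqF.
  by rewrite mulr_ge0 ?sqr_ge0 // invr_ge0 ltW.
by have := H (complex.Re z) (complex.Re y); have := H (complex.Im z) (complex.Im y); lra.
Qed.

Lemma sqmodD_le2 z y : sqmod (z + y) <= 2 * sqmod z + 2 * sqmod y.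
Proof. by have := sqmodD_le z y ltr01; rewrite invr1. Qed.

End ComplexScalars.



(** * Integration of real and complex functions *)

Section RealIntegrals.
Context d (T : measurableType d) (R : realType).
Variable mu : {measure set T -> \bar R}.
Implicit Types (f g h : T -> R).
Local Notation rint f := (mu.-integrable setT (EFin \o f)).

Lemma rint_measurable f : rint f -> measurable_fun setT f.
Proof. by move=> /measurable_int /measurable_EFinP. Qed.

Lemma measurable_set_lt f g : measurable_fun setT f -> measurable_fun setT g ->
  measurable [set x | f x < g x].
Proof.
move=> mf mg; have := measurable_fun_ltr mf mg measurableT (Y := [set true]).
by rewrite setTI; apply.
Qed.

Lemma measurable_set_le f g : measurable_fun setT f -> measurable_fun setT g ->
  measurable [set x | f x <= g x].
Proof.
move=> mf mg; have := measurable_fun_ler mf mg measurableT (Y := [set true]).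
by rewrite setTI; apply.
Qed.

Lemma rintD f g : rint f -> rint g -> rint (fun x => f x + g x).
Proof. by move=> fi gi; have := integrableD measurableT fi gi. Qed.

Lemma rintB f g : rint f -> rint g -> rint (fun x => f x - g x).
Proof. by move=> fi gi; by have := integrableB measurableT fi gi. Qed.

Lemma rintZ (k : R) f : rint f -> rint (fun x => k * f x).
Proof. by move=> fi; by have := integrableZl measurableT k fi. Qed.

Lemma rint_le f g : measurable_fun setT f -> (forall x, `|f x| <= g x) ->
  rint g -> rint f.
Proof.
move=> mf fg gi; apply: (le_integrable measurableT _ _ gi).
  exact/measurable_EFinP.
move=> x _ /=; rewrite lee_fin (le_trans (fg x)) //.
by rewrite ger0_norm // (le_trans _ (fg x)).
Qed.

Lemma rintM (C : R) f g : rint f -> measurable_fun setT g ->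
  (forall x, `|g x| <= C) -> rint (fun x => f x * g x).
Proof.
move=> fi mg gC.
apply: (@rint_le _ (fun x => C * `|f x|)).
- by apply: measurable_funM => //; exact: rint_measurable.
- by move=> x; rewrite normrM mulrC ler_wpM2r.
- apply: rintZ; exact: (integrable_norm fi).
Qed.

Lemma rint_ge0P f : measurable_fun setT f -> (forall x, 0 <= f x) ->
  rint f <-> (\int[mu]_x (f x)%:E < +oo)%E.
Proof.
move=> mf f0; split=> [/integrableP[_]|fi].
  by under eq_integral do rewrite /= ger0_norm//.
apply/integrableP; split; first exact/measurable_EFinP.
by under eq_integral do rewrite /= ger0_norm//.
Qed.

Lemma rint_intE f : rint f -> (\int[mu]_x (f x)%:E)%E = (Rintegral mu setT f)%:E.
Proof. by move=> fi; rewrite /Rintegral fineK //; exact: integrable_fin_num. Qed.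

(** The integrand is nonpositive by construction, so a nonnegative integral
    forces it to vanish almost everywhere. *)
Lemma ae_ge0_of_integral h : rint h ->
  0 <= Rintegral mu setT (fun x => \1_[set y | h y < 0] x * h x) ->
  {ae mu, forall x, 0 <= h x}.
Proof.
move=> hi.
have mh := rint_measurable hi.
set N := [set y | h y < 0].
have mN : measurable N by apply: measurable_set_lt => //; exact: measurable_cst.
pose g x := \1_N x * - h x.
have g0 x : 0 <= g x.
  rewrite /g indicE; case: (boolP (x \in N)) => [|_]; last by rewrite mul0r.
  by rewrite inE /N /= => /ltW; rewrite mul1r oppr_ge0.
have mg : measurable_fun setT g.
  by apply: measurable_funM; [exact: measurable_indic|exact: measurable_funN].
have gi : rint g.
  apply: (@rint_le g (fun x => `|h x|) mg); last exact: (integrable_norm hi).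
  move=> x; rewrite /g normrM normrN ler_piMl //.
  by rewrite indicE; case: (_ \in _); rewrite ?normr1 ?normr0.
have -> : Rintegral mu setT (fun x => \1_N x * h x) = - Rintegral mu setT g.
  rewrite -mulN1r -RintegralZl //; apply: eq_Rintegral => x _.
  by rewrite /g; ring.
rewrite oppr_ge0 => le0.
have : (\int[mu]_x `|(g x)%:E| = 0)%E.
  under eq_integral do rewrite /= ger0_norm//.
  rewrite rint_intE //; congr EFin; apply/eqP; rewrite eq_le le0 /=.
  by apply: Rintegral_ge0 => x _; apply: g0.
move/ae_eq_integral_abs => /(_ measurableT).
have mg' : measurable_fun setT (EFin \o g) by apply/measurable_EFinP.
move=> /(_ mg'); apply: filterS => x /(_ I) [] /= /eqP.
rewrite /g indicE; case: (boolP (x \in N)).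
  by rewrite inE /N /= => lt0; rewrite mul1r oppr_eq0 => /eqP ->.
by rewrite notin_setE /N /= => /negP; rewrite -leNgt.
Qed.

End RealIntegrals.

Section ComplexIntegrals.
Context d (T : measurableType d) (R : realType).
Variable mu : {measure set T -> \bar R}.
Implicit Types (f g h : T -> R[i]).
Local Notation rint f := (mu.-integrable setT (EFin \o f)).

Definition cmeasurable f :=
  measurable_fun setT (fun x => complex.Re (f x)) /\
  measurable_fun setT (fun x => complex.Im (f x)).

Definition cbounded f := exists C : R, forall x, sqmod (f x) <= C.

Lemma cmeasurableD f g : cmeasurable f -> cmeasurable g ->
  cmeasurable (fun x => f x + g x).
Proof.
move=> [f1 f2] [g1 g2]; split; under eq_fun do rewrite !Re_Im;
  exact: measurable_funD.
Qed.

Lemma cmeasurableM f g : cmeasurable f -> cmeasurable g ->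
  cmeasurable (fun x => f x * g x).
Proof.
move=> [f1 f2] [g1 g2]; split; under eq_fun do rewrite !Re_Im.
  by apply: measurable_funB; exact: measurable_funM.
by apply: measurable_funD; exact: measurable_funM.
Qed.

Lemma cmeasurableN f : cmeasurable f -> cmeasurable (fun x => - f x).
Proof.
move=> [f1 f2]; split; under eq_fun do rewrite !Re_Im;
  exact: measurable_funN.
Qed.

Lemma cmeasurableB f g : cmeasurable f -> cmeasurable g ->
  cmeasurable (fun x => f x - g x).
Proof. by move=> mf mg; apply: cmeasurableD => //; exact: cmeasurableN. Qed.

Lemma cmeasurableJ f : cmeasurable f -> cmeasurable (fun x => (f x)^*).
Proof.
move=> [f1 f2]; split; under eq_fun do rewrite !Re_Im; first exact: f1.
exact: measurable_funN.
Qed.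

Lemma cmeasurable_cst c : cmeasurable (fun=> c).
Proof. by split; exact: measurable_cst. Qed.

Lemma cmeasurable_sum I (s : seq I) (F : I -> T -> R[i]) :
  (forall i, cmeasurable (F i)) -> cmeasurable (fun x => \sum_(i <- s) F i x).
Proof.
move=> mF; elim: s => [|i s IH].
  by under eq_fun do rewrite big_nil; exact: cmeasurable_cst.
by under eq_fun do rewrite big_cons; exact: cmeasurableD.
Qed.

Lemma cmeasurable_real (r : T -> R) : measurable_fun setT r ->
  cmeasurable (fun x => (r x)%:C%C).
Proof. by move=> mr; split => //=; exact: measurable_cst. Qed.

Lemma measurable_sqmod f : cmeasurable f -> measurable_fun setT (fun x => sqmod (f x)).
Proof.
move=> [f1 f2]; under eq_fun do rewrite sqmodE.
by apply: measurable_funD; exact: measurable_funX.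
Qed.

Lemma cboundedD f g : cbounded f -> cbounded g -> cbounded (fun x => f x + g x).
Proof.
move=> [A fA] [B gB]; exists (2 * A + 2 * B) => x.
have := sqmodD_le2 (f x) (g x); have := fA x; have := gB x; lra.
Qed.

Lemma cboundedM f g : cbounded f -> cbounded g -> cbounded (fun x => f x * g x).
Proof.
move=> [A fA] [B gB]; exists (A * B) => x.
by rewrite sqmodM ler_pM ?sqmod_ge0.
Qed.

Lemma cboundedJ f : cbounded f -> cbounded (fun x => (f x)^*).
Proof. by move=> [A fA]; exists A => x; rewrite sqmodJ. Qed.

Lemma cbounded_cst c : cbounded (fun=> c).
Proof. by exists (sqmod c). Qed.

Lemma cbounded_sum I (s : seq I) (F : I -> T -> R[i]) :
  (forall i, cbounded (F i)) -> cbounded (fun x => \sum_(i <- s) F i x).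
Proof.
move=> bF; elim: s => [|i s [C IH]].
  by exists 0 => x; rewrite big_nil sqmod0.
have [D FD] := bF i.
have [E FE] := cboundedD (bF i) (ex_intro _ C IH).
by exists E => x; rewrite big_cons; exact: FE.
Qed.

Lemma normr_sqmod (z : R[i]) (C : R) : sqmod z <= C ->
  `|complex.Re z| <= C + 1 /\ `|complex.Im z| <= C + 1.
Proof.
rewrite sqmodE => zC.
have H (a b : R) : a ^+ 2 + b ^+ 2 <= C -> `|a| <= C + 1.
  rewrite ler_norml => h; apply/andP; split; nra.
split; [exact: H zC|apply: H; rewrite addrC; exact: zC].
Qed.

Lemma cintegrable_measurable f : cintegrable mu f -> cmeasurable f.
Proof. by move=> [/rint_measurable ? /rint_measurable ?]. Qed.

Lemma cintegrableD f g : cintegrable mu f -> cintegrable mu g ->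
  cintegrable mu (fun x => f x + g x).
Proof.
move=> [f1 f2] [g1 g2]; split.
  by rewrite /comp; under eq_fun do rewrite !Re_Im; exact: rintD.
by rewrite /comp; under eq_fun do rewrite !Re_Im; exact: rintD.
Qed.

Lemma cintegrableM f g : cintegrable mu f -> cmeasurable g -> cbounded g ->
  cintegrable mu (fun x => f x * g x).
Proof.
move=> [f1 f2] [g1 g2] [C gC].
have b1 x := (normr_sqmod (gC x)).1.
have b2 x := (normr_sqmod (gC x)).2.
split; rewrite /comp; under eq_fun do rewrite !Re_Im.
  apply: rintB.
  exact: (rintM f1 g1 b1).
  exact: (rintM f2 g2 b2).
exact: (rintD (rintM f1 g2 b2) (rintM f2 g1 b1)).
Qed.

Lemma cintegrableZ c f : cintegrable mu f -> cintegrable mu (fun x => c * f x).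
Proof.
move=> [f1 f2]; split; rewrite /comp; under eq_fun do rewrite !Re_Im.
  by apply: rintB; exact: rintZ.
by apply: rintD; exact: rintZ.
Qed.

Lemma cintegrable0 : cintegrable mu (fun=> 0).
Proof. by split; exact: integrable0. Qed.

Lemma cintegrable_sum I (s : seq I) (F : I -> T -> R[i]) :
  (forall i, cintegrable mu (F i)) -> cintegrable mu (fun x => \sum_(i <- s) F i x).
Proof.
move=> iF; elim: s => [|i s IH].
  by under [X in cintegrable _ X]eq_fun do rewrite big_nil; exact: cintegrable0.
by under [X in cintegrable _ X]eq_fun do rewrite big_cons; exact: cintegrableD.
Qed.

Lemma cintegralD f g : cintegrable mu f -> cintegrable mu g ->
  cintegral mu (fun x => f x + g x) = cintegral mu f + cintegral mu g.
Proof.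
move=> [f1 f2] [g1 g2]; apply: complex_eq; rewrite Re_Im /=.
  by under eq_Rintegral do rewrite Re_Im; rewrite RintegralD.
by under eq_Rintegral do rewrite Re_Im; rewrite RintegralD.
Qed.

Lemma cintegral0 : cintegral mu (fun=> 0) = 0.
Proof. by apply: complex_eq => /=; rewrite Rintegral_cst // mul0r. Qed.

Lemma cintegralZ c f : cintegrable mu f ->
  cintegral mu (fun x => c * f x) = c * cintegral mu f.
Proof.
move=> [f1 f2]; apply: complex_eq; rewrite Re_Im /=.
  under eq_Rintegral do rewrite Re_Im.
  by rewrite RintegralB ?RintegralZl //; exact: rintZ.
under eq_Rintegral do rewrite Re_Im.
by rewrite RintegralD ?RintegralZl //; exact: rintZ.
Qed.

Lemma cintegral_sum I (s : seq I) (F : I -> T -> R[i]) :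
  (forall i, cintegrable mu (F i)) ->
  cintegral mu (fun x => \sum_(i <- s) F i x) = \sum_(i <- s) cintegral mu (F i).
Proof.
move=> iF; elim: s => [|i s IH].
  under [X in cintegral _ X]eq_fun do rewrite big_nil.
  by rewrite big_nil cintegral0.
under [X in cintegral _ X]eq_fun do rewrite big_cons.
by rewrite big_cons cintegralD ?IH //; exact: cintegrable_sum.
Qed.

End ComplexIntegrals.

(** * Density of an algebra of bounded functions in weighted square-integrable functions *)

Section SignPolynomial.
Context {R : realType}.
Implicit Types (t : R).

(** The iterates of this odd cubic, which maps [-1, 1] to itself and pushes
    every nonzero point towards the endpoint of the same sign, are polynomials
    converging boundedly to the sign function. *)
Definition sign_step t : R := t * (3 - t ^+ 2) / 2.

Lemma sign_stepN t : sign_step (- t) = - sign_step t.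
Proof. by rewrite /sign_step sqrrN !mulNr. Qed.

Lemma sign_step_le1 t : -1 <= t -> sign_step t <= 1.
Proof.
move=> t1; rewrite -subr_ge0.
have -> : 1 - sign_step t = (1 - t) ^+ 2 * (2 + t) / 2 by rewrite /sign_step; field.
by rewrite divr_ge0 // mulr_ge0 ?sqr_ge0 //; lra.
Qed.

Lemma sign_step_ge t : 0 <= t <= 1 -> t <= sign_step t <= 1.
Proof.
move=> /andP[t0 t1]; rewrite sign_step_le1 ?andbT; last by lra.
rewrite -subr_ge0.
have -> : sign_step t - t = t * ((1 - t) * (1 + t)) / 2 by rewrite /sign_step; field.
by rewrite divr_ge0 // !mulr_ge0 //; lra.
Qed.

Lemma sign_step_norm t : `|t| <= 1 -> `|sign_step t| <= 1.
Proof.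
rewrite !ler_norml => /andP[t0 t1].
by rewrite sign_step_le1 // andbT lerNl -sign_stepN sign_step_le1 // lerN2.
Qed.

Lemma iter_sign_norm n t : `|t| <= 1 -> `|iter n sign_step t| <= 1.
Proof. by move=> t1; elim: n => //= n IH; exact: sign_step_norm. Qed.

Lemma iter_signN n t : iter n sign_step (- t) = - iter n sign_step t.
Proof. by elim: n => //= n ->; rewrite sign_stepN. Qed.

Lemma iter_sign_pos n t : 0 < t <= 1 ->
  t <= iter n sign_step t <= 1 /\ 1 - iter n sign_step t <= (1 - t / 2) ^+ n.
Proof.
move=> /andP[t0 t1]; elim: n => [|n [/andP[lo hi] gap]] /=.
  by rewrite lexx t1 expr0; split=> //; lra.
set s := iter n sign_step t in lo hi gap *.
have s01 : 0 <= s <= 1 by apply/andP; split; lra.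
have /andP[s2 s3] := sign_step_ge s01.
split; first by rewrite s3 andbT; lra.
have step : 1 - sign_step s <= (1 - s) * (1 - t / 2).
  have -> : 1 - sign_step s = (1 - s) * (1 - s) * (2 + s) / 2.
    by rewrite /sign_step; field.
  nra.
by rewrite exprSr (le_trans step)// ler_wpM2r //; lra.
Qed.

Lemma cvg_iter_sign_pos t : 0 < t <= 1 ->
  (fun n => iter n sign_step t) @ \oo --> (1 : R).
Proof.
move=> t01; have /andP[t0 t1] := t01.
apply: (@squeeze_cvgr _ _ _ _ (fun n => 1 - (1 - t / 2) ^+ n) (fun=> 1)).
- near=> n; have [/andP[_ ->] gap] := iter_sign_pos n t01.
  by rewrite andbT; lra.
- rewrite -[X in _ --> X]subr0; apply: cvgB; first exact: cvg_cst.
  by apply: cvg_expr; rewrite ger0_norm; lra.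
- exact: cvg_cst.
Unshelve. all: by end_near. Qed.

Lemma cvg_iter_sign t : `|t| <= 1 ->
  (fun n => iter n sign_step t) @ \oo --> Num.sg t.
Proof.
move=> tle; case: (ltgtP t 0) => [tn|tp|->].
- rewrite ltr0_sg //; have tn' : 0 < - t <= 1.
    by rewrite oppr_gt0 tn -(ltr0_norm tn).
  rewrite (_ : (fun n => _) = fun n => - iter n sign_step (- t)); last first.
    by apply/funext => n; rewrite iter_signN opprK.
  exact: (cvgN (cvg_iter_sign_pos tn')).
- by rewrite gtr0_sg //; apply: cvg_iter_sign_pos; rewrite tp -(gtr0_norm tp).
- rewrite sgr0; apply: cvg_near_cst; near=> n.
  by elim: (n) => //= m ->; rewrite /sign_step !mul0r.
Unshelve. all: by end_near. Qed.

End SignPolynomial.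

Lemma scaled_sum_factor (R : comPzRingType) (k1 k2 a b c : R) :
  k1 * (a * c) + k2 * (b * c) = (k1 * a + k2 * b) * c.
Proof. by ring. Qed.

Lemma cvg_to_EFin (R : realType) (u : nat -> R) (l : R) :
  u @ \oo --> l -> (fun n => (u n)%:E) @ \oo --> l%:E.
Proof.
by move=> c; apply: cvg_EFin; [near=> n|exact: c].
Unshelve. all: by end_near. Qed.

Section Approximation.
Context d (T : measurableType d) (R : realType).
Variable mu : {measure set T -> \bar R}.
Implicit Types (f g p q : T -> R[i]).
Local Notation rint f := (mu.-integrable setT (EFin \o f)).

(** The model is the algebra of trigonometric polynomials; products and
    constants are what make indicators of sets accessible. *)
Record test_algebra (P : set (T -> R[i])) := TestAlgebra {
  test_measurable : forall p, P p -> cmeasurable p;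
  test_bounded : forall p, P p -> cbounded p;
  test_cst : forall c, P (fun=> c);
  test_add : forall p q, P p -> P q -> P (fun x => p x + q x);
  test_mul : forall p q, P p -> P q -> P (fun x => p x * q x) }.

Variables (P : set (T -> R[i])) (algP : test_algebra P).
Variables (w : T -> R) (w_ge0 : forall x, 0 <= w x) (iw : rint w).

(** Squared distance in L^2(w mu), extended-real valued so that finiteness need
    not be established beforehand. *)
Definition wdist f p : \bar R := (\int[mu]_x (sqmod (f x - p x) * w x)%:E)%E.

Definition approximable f :=
  forall e : R, 0 < e -> exists p, P p /\ (wdist f p < e%:E)%E.

Let mw : measurable_fun setT w := rint_measurable iw.

Lemma ge0_le_lin_integral (F G1 G2 : T -> R) (k1 k2 : R) :
  0 <= k1 -> 0 <= k2 ->
  measurable_fun setT F -> measurable_fun setT G1 -> measurable_fun setT G2 ->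
  (forall x, 0 <= F x) -> (forall x, 0 <= G1 x) -> (forall x, 0 <= G2 x) ->
  (forall x, F x <= k1 * G1 x + k2 * G2 x) ->
  (\int[mu]_x (F x)%:E <=
     k1%:E * \int[mu]_x (G1 x)%:E + k2%:E * \int[mu]_x (G2 x)%:E)%E.
Proof.
move=> k10 k20 mF mG1 mG2 F0 G10 G20 H.
have eF : measurable_fun setT (EFin \o F) by apply/measurable_EFinP.
have e1 : measurable_fun setT (EFin \o G1) by apply/measurable_EFinP.
have e2 : measurable_fun setT (EFin \o G2) by apply/measurable_EFinP.
have f1 : measurable_fun setT (fun x => k1%:E * (G1 x)%:E)%E by exact: measurable_funeM.
have f2 : measurable_fun setT (fun x => k2%:E * (G2 x)%:E)%E by exact: measurable_funeM.
rewrite -(ge0_integralZl mu measurableT e1) -?(ge0_integralZl mu measurableT e2) //;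
  try by move=> x _; rewrite lee_fin.
rewrite -(ge0_integralD mu measurableT _ f1 _ f2) //;
  try by move=> x _; rewrite -EFinM lee_fin mulr_ge0.
apply: ge0_le_integral => //; try exact: emeasurable_funD.
- by move=> x _; rewrite lee_fin.
- by move=> x _; rewrite -!EFinM -EFinD lee_fin.
Qed.

Lemma measurable_wdist f p : cmeasurable f -> cmeasurable p ->
  measurable_fun setT (fun x => sqmod (f x - p x) * w x).
Proof.
move=> mf mp; apply: measurable_funM => //.
by apply: measurable_sqmod; exact: cmeasurableB.
Qed.

Lemma wdist_triangle g f p : cmeasurable g -> cmeasurable f -> cmeasurable p ->
  (wdist f p <= 2%:E * wdist f g + 2%:E * wdist g p)%E.
Proof.
move=> mg mf mp; apply: ge0_le_lin_integral => //; try exact: measurable_wdist.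
- by move=> x; rewrite mulr_ge0 ?sqmod_ge0.
- by move=> x; rewrite mulr_ge0 ?sqmod_ge0.
- by move=> x; rewrite mulr_ge0 ?sqmod_ge0.
move=> x; rewrite scaled_sum_factor ler_wpM2r //.
have -> : f x - p x = (f x - g x) + (g x - p x) by rewrite addrA subrK.
exact: sqmodD_le2.
Qed.

Lemma wdist_fin f p (e k : R) : 0 < k -> (wdist f p < (e / k)%:E)%E ->
  (k%:E * wdist f p < e%:E)%E.
Proof.
move=> k0 h; have -> : e%:E = (k%:E * (e / k)%:E)%E.
  by rewrite -EFinM mulrCA divff ?mulr1 // gt_eqF.
by rewrite lte_pmul2l // lte_fin.
Qed.

Lemma approximable_test p : P p -> approximable p.
Proof.
move=> Pp e e0; exists p; split => //; rewrite /wdist.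
under eq_integral do rewrite subrr sqmod0 mul0r.
by rewrite integral0 lte_fin.
Qed.

Lemma approximableD f g : cmeasurable f -> cmeasurable g ->
  approximable f -> approximable g -> approximable (fun x => f x + g x).
Proof.
move=> mf mg af ag e e0.
have e4 : 0 < (e / 2) / 2 by rewrite !divr_gt0.
have [p [Pp dp]] := af _ e4.
have [q [Pq dq]] := ag _ e4.
exists (fun x => p x + q x); split; first exact: (test_add algP).
have mp := test_measurable algP Pp; have mq := test_measurable algP Pq.
have le : (wdist (fun x => (f x + g x)%R) (fun x => (p x + q x)%R) <=
    2%:E * wdist f p + 2%:E * wdist g q)%E.
  apply: ge0_le_lin_integral => //; try exact: measurable_wdist.
  - by apply: measurable_wdist; exact: cmeasurableD.
  - by move=> x; rewrite mulr_ge0 ?sqmod_ge0.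
  - by move=> x; rewrite mulr_ge0 ?sqmod_ge0.
  - by move=> x; rewrite mulr_ge0 ?sqmod_ge0.
  move=> x; rewrite scaled_sum_factor ler_wpM2r //.
  have -> : f x + g x - (p x + q x) = (f x - p x) + (g x - q x).
    by rewrite opprD addrACA.
  exact: sqmodD_le2.
apply: (le_lt_trans le); have -> : e%:E = ((e / 2)%:E + (e / 2)%:E)%E.
  by rewrite -EFinD -splitr.
by apply: lteD; exact: wdist_fin.
Qed.

(** One factor is replaced by a test function first, and only then is the
    accuracy needed for the other factor chosen. *)
Lemma approximableM f g : cmeasurable f -> cmeasurable g -> cbounded g ->
  approximable f -> approximable g -> approximable (fun x => f x * g x).
Proof.
move=> mf mg [C gC] af ag e e0.
have C0 : 0 < 2 * (`|C| + 1) by rewrite mulr_gt0 // ltr_wpDl.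
have ep : 0 < (e / 2) / (2 * (`|C| + 1)) by rewrite !divr_gt0.
have [p [Pp dp]] := af _ ep.
have [D pD] := test_bounded algP Pp.
have D0 : 0 < 2 * (`|D| + 1) by rewrite mulr_gt0 // ltr_wpDl.
have eq : 0 < (e / 2) / (2 * (`|D| + 1)) by rewrite !divr_gt0.
have [q [Pq dq]] := ag _ eq.
exists (fun x => p x * q x); split; first exact: (test_mul algP).
have mp := test_measurable algP Pp; have mq := test_measurable algP Pq.
have le : (wdist (fun x => (f x * g x)%R) (fun x => (p x * q x)%R) <=
    (2 * (`|C| + 1))%:E * wdist f p + (2 * (`|D| + 1))%:E * wdist g q)%E.
  apply: ge0_le_lin_integral; try exact: measurable_wdist; try exact: ltW.
  - by apply: measurable_wdist; exact: cmeasurableM.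
  - by move=> x; rewrite mulr_ge0 ?sqmod_ge0.
  - by move=> x; rewrite mulr_ge0 ?sqmod_ge0.
  - by move=> x; rewrite mulr_ge0 ?sqmod_ge0.
  move=> x; rewrite scaled_sum_factor ler_wpM2r //.
  have -> : f x * g x - p x * q x = g x * (f x - p x) + p x * (g x - q x) by ring.
  apply: (le_trans (sqmodD_le2 _ _)).
  rewrite !sqmodM -(mulrA 2 (_ + 1)) -(mulrA 2 (`|D| + 1)).
  apply: lerD; rewrite ler_pM2l //.
    rewrite ler_wpM2r ?sqmod_ge0 // (le_trans (gC x)) //.
    by rewrite (le_trans (ler_norm C)) // lerDl.
  rewrite ler_wpM2r ?sqmod_ge0 // (le_trans (pD x)) //.
  by rewrite (le_trans (ler_norm D)) // lerDl.
apply: (le_lt_trans le); have -> : e%:E = ((e / 2)%:E + (e / 2)%:E)%E.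
  by rewrite -EFinD -splitr.
by apply: lteD; exact: wdist_fin.
Qed.

Definition rapproximable (f : T -> R) :=
  [/\ measurable_fun setT f, (exists C, forall x, `|f x| <= C) &
      approximable (fun x => (f x)%:C%C)].

Lemma cbounded_real (f : T -> R) C : (forall x, `|f x| <= C) ->
  cbounded (fun x => (f x)%:C%C).
Proof.
move=> fC; exists (C ^+ 2) => x; rewrite sqmod_real -(real_normK (num_real _)).
by rewrite ler_sqr ?nnegrE // (le_trans _ (fC x)).
Qed.

Lemma rapproximable_cst (c : R) : rapproximable (fun=> c).
Proof.
split; [exact: measurable_cst|by exists `|c| => x|].
by apply: approximable_test; exact: (test_cst algP).
Qed.

Lemma rapproximableD (f g : T -> R) : rapproximable f -> rapproximable g ->
  rapproximable (fun x => f x + g x).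
Proof.
move=> [mf [A fA] af] [mg [B gB] ag]; split.
- exact: measurable_funD.
- by exists (A + B) => x; rewrite (le_trans (ler_normD _ _)) // lerD.
- under [X in approximable X]eq_fun do rewrite rmorphD.
  by apply: approximableD => //; exact: cmeasurable_real.
Qed.

Lemma rapproximableM (f g : T -> R) : rapproximable f -> rapproximable g ->
  rapproximable (fun x => f x * g x).
Proof.
move=> [mf [A fA] af] [mg [B gB] ag]; split.
- exact: measurable_funM.
- by exists (A * B) => x; rewrite normrM ler_pM.
- under [X in approximable X]eq_fun do rewrite rmorphM.
  by apply: approximableM => //; try exact: cmeasurable_real; exact: cbounded_real gB.
Qed.

Lemma rapproximable_sum I (s : seq I) (F : I -> T -> R) :
  (forall i, rapproximable (F i)) -> rapproximable (fun x => \sum_(i <- s) F i x).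
Proof.
move=> aF; elim: s => [|i s IH].
  by under [X in rapproximable X]eq_fun do rewrite big_nil; exact: rapproximable_cst.
by under [X in rapproximable X]eq_fun do rewrite big_cons; exact: rapproximableD.
Qed.

Lemma rapproximable_lim (f_ : (T -> R)^nat) (f : T -> R) (C : R) :
  (forall n, rapproximable (f_ n)) -> (forall n x, `|f_ n x| <= C) ->
  (forall x, f_ ^~ x @ \oo --> f x) -> rapproximable f.
Proof.
move=> af fC cf.
have mf : measurable_fun setT f.
  by apply: (@measurable_fun_cvg _ _ _ _ f_) => [n|x _]; [case: (af n)|exact: cf].
have fleC x : `|f x| <= C.
  have cn : (fun n => `|f_ n x|) @ \oo --> `|f x| by apply: cvg_norm; exact: cf.
  by rewrite -(cvg_lim (@Rhausdorff R) cn); apply: limr_le;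
    [apply/cvg_ex; exists `|f x| | near=> n; exact: fC].
split=> //; first by exists C.
move=> e e0.
pose F n x := (sqmod ((f x)%:C%C - (f_ n x)%:C%C) * w x)%:E.
have mF n : measurable_fun setT (F n).
  apply/measurable_EFinP; apply: measurable_wdist; apply: cmeasurable_real => //.
  by case: (af n).
have cF x : F ^~ x @ \oo --> 0%E.
  rewrite /F; under eq_fun do rewrite -rmorphB /= sqmod_real.
  apply: cvg_to_EFin.
  have c0 : (fun n => f x - f_ n x) @ \oo --> f x - f x.
    by apply: cvgB; [exact: cvg_cst|exact: cf].
  have cw : (fun=> w x) @ \oo --> w x by exact: cvg_cst.
  have := cvgM (cvgM c0 c0) cw; rewrite subrr !mul0r; exact.
have iG : rint (fun x => (2 * C) ^+ 2 * w x) by exact: rintZ.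
have bF n x : (`|F n x|%E <= ((2 * C) ^+ 2 * w x)%:E)%E.
  rewrite /F gee0_abs ?lee_fin; last by rewrite mulr_ge0 ?sqmod_ge0.
  rewrite -rmorphB /= sqmod_real.
  rewrite ler_wpM2r // -(real_normK (num_real (f x - _))) ler_sqr ?nnegrE //; last first.
    by rewrite mulr_ge0 // (le_trans _ (fleC x)).
  by rewrite (le_trans (ler_normB _ _)) // mulr_natl mulr2n lerD.
have aeF : {ae mu, forall x, setT x -> F ^~ x @ \oo --> cst 0%E x}.
  exact: (aeW mu (fun x _ => cF x)).
have aeB : {ae mu, forall x n, setT x -> (`|F n x|%E <= ((2 * C) ^+ 2 * w x)%:E)%E}.
  exact: (aeW mu (fun x n _ => bF n x)).
have [_ _] := dominated_convergence measurableT mF (measurable_cst _) aeF iG aeB.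
rewrite /= integral0.
have e4 : 0 < (e / 2) / 2 by rewrite !divr_gt0.
move=> /fine_cvgP[fin /cvgr0Pnorm_lt /(_ _ e4) near_e].
have [n [finn lt_e]] : exists n, (\int[mu]_x F n x)%E \is a fin_num /\
    `|fine (\int[mu]_x F n x)%E| < e / 2 / 2.
  by have [N _ /(_ _ (leqnn N)) H] := filterI fin near_e; exists N.
have [_ _ an] := af n.
have [p [Pp dp]] := an _ e4.
exists p; split=> //.
have mp := test_measurable algP Pp.
have mfn : cmeasurable (fun x => (f_ n x)%:C%C) by case: (af n) => ? _ _; exact: cmeasurable_real.
apply: (le_lt_trans (wdist_triangle mfn (cmeasurable_real mf) mp)).
have -> : e%:E = ((e / 2)%:E + (e / 2)%:E)%E by rewrite -EFinD -splitr.
apply: lteD; apply: wdist_fin => //.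
rewrite /wdist -(fineK finn) lte_fin (le_lt_trans _ lt_e) //; exact: ler_norm.
Unshelve. all: by end_near. Qed.

(** The indicator of u > 0 is (sg u ^ 2 + sg u) / 2, and sg u is a bounded limit
    of polynomials in u. *)
Lemma rapproximable_pos (u : T -> R) : (forall x, `|u x| <= 1) ->
  rapproximable u -> rapproximable (fun x => \1_[set y | 0 < u y] x).
Proof.
move=> u1 au.
have a_iter n : rapproximable (fun x => iter n sign_step (u x)).
  elim: n => //= n IH; rewrite /sign_step.
  under [X in rapproximable X]eq_fun do rewrite expr2.
  apply: rapproximableM; last exact: rapproximable_cst.
  apply: rapproximableM => //; apply: rapproximableD; first exact: rapproximable_cst.
  under [X in rapproximable X]eq_fun do rewrite -mulN1r.
  apply: rapproximableM; first exact: rapproximable_cst.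
  exact: rapproximableM.
have asg : rapproximable (fun x => Num.sg (u x)).
  apply: (rapproximable_lim (C := 1) a_iter) => [n x|x].
    exact: iter_sign_norm.
  exact: cvg_iter_sign.
have -> : (fun x => \1_[set y | 0 < u y] x) =
    (fun x => (Num.sg (u x) * Num.sg (u x) + Num.sg (u x)) * (2^-1)).
  apply/funext => x; rewrite indicE; case: (ltgtP (u x) 0) => h.
  - rewrite memNset /=; last by move=> /(lt_trans h); rewrite ltxx.
    by rewrite ltr0_sg //; field.
  - by rewrite mem_set //= gtr0_sg //; field.
  - by rewrite memNset /= h ?ltxx // sgr0; field.
apply: rapproximableM; last exact: rapproximable_cst.
by apply: rapproximableD => //; exact: rapproximableM.
Qed.

Lemma rapproximable_gt (u : T -> R) (r : R) : (forall x, `|u x| <= 1) ->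
  rapproximable u -> rapproximable (fun x => \1_[set y | r < u y] x).
Proof.
move=> u1 au.
have k0 : 0 < 1 + `|r| by rewrite ltr_pwDl.
have -> : [set y | r < u y] = [set y | 0 < (u y + - r) * (1 + `|r|)^-1].
  by apply/seteqP; split => y /=; rewrite pmulr_lgt0 ?invr_gt0 // subr_gt0.
apply: rapproximable_pos.
  move=> x; rewrite normrM normfV [X in _ / X]gtr0_norm // ler_pdivrMr // mul1r.
  by rewrite (le_trans (ler_normB _ _)) // lerD.
apply: rapproximableM; last exact: rapproximable_cst.
by apply: rapproximableD => //; exact: rapproximable_cst.
Qed.

Definition approximable_set : set (set T) :=
  [set E | rapproximable (fun x => \1_E x)].

Lemma approximable_setC E : approximable_set E -> approximable_set (~` E).
Proof.
rewrite /approximable_set /= => aE.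
have -> : (fun x => \1_(~` E) x) = (fun x => 1 + (-1) * \1_E x) :> (T -> R).
  by apply/funext => x; rewrite !indicE in_setC; case: (x \in E); rewrite /=; ring.
apply: rapproximableD; first exact: rapproximable_cst.
by apply: rapproximableM => //; exact: rapproximable_cst.
Qed.

Lemma approximable_setI E F :
  approximable_set E -> approximable_set F -> approximable_set (E `&` F).
Proof.
rewrite /approximable_set /= => aE aF.
have -> : (fun x => \1_(E `&` F) x) = (fun x => \1_E x * \1_F x) :> (T -> R).
  by apply/funext => x; rewrite !indicE in_setI; case: (x \in E); case: (x \in F); rewrite /=; ring.
exact: rapproximableM.
Qed.

Lemma approximable_set0 : approximable_set set0.
Proof.
rewrite /approximable_set /=.
have -> : (fun x => \1_set0 x) = (fun=> 0) :> (T -> R).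
  by apply/funext => x; rewrite indicE in_set0.
exact: rapproximable_cst.
Qed.

Lemma approximable_setU E F :
  approximable_set E -> approximable_set F -> approximable_set (E `|` F).
Proof.
move=> aE aF; rewrite -[_ `|` _]setCK setCU.
by apply: approximable_setC; apply: approximable_setI; exact: approximable_setC.
Qed.

Lemma approximable_bigcup (E : (set T)^nat) :
  (forall n, approximable_set (E n)) -> approximable_set (\bigcup_n E n).
Proof.
move=> aE.
have aU n : approximable_set (\big[setU/set0]_(i < n) E i).
  elim: n => [|n IH]; first by rewrite big_ord0; exact: approximable_set0.
  by rewrite big_ord_recr; exact: approximable_setU.
apply: (rapproximable_lim (C := 1) aU) => [n x|x].
  by rewrite indicE; case: (_ \in _); rewrite ?normr1 ?normr0.
apply: cvg_near_cst; rewrite !indicE; case: (boolP (x \in \bigcup_n E n)).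
  rewrite inE => -[m _ Emx]; near=> n; rewrite indicE mem_set //.
  rewrite -bigcup_mkord; exists m => //=; near: n; exact: nbhs_infty_gt.
rewrite notin_setE => nE; near=> n; rewrite indicE memNset //.
by rewrite -bigcup_mkord => -[m _ Em]; apply: nE; exists m.
Unshelve. all: by end_near. Qed.

(** The sets with approximable indicator form a sigma-algebra, so a generating
    family decides about all measurable sets; simple functions and bounded
    limits then reach every bounded measurable function. *)
Lemma approximable_bounded (G : set (set T)) :
  (forall E, measurable E -> smallest (sigma_algebra setT) G E) ->
  (forall E, G E -> approximable_set E) ->
  forall f, cmeasurable f -> cbounded f -> approximable f.
Proof.
move=> genG aG.
have aE E : measurable E -> approximable_set E.
  move=> /genG; apply: smallest_sub => //; split.
  - exact: approximable_set0.
  - by move=> A aA; rewrite setTD; exact: approximable_setC.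
  - exact: approximable_bigcup.
have apos (f : T -> R) C : measurable_fun setT f -> (forall x, 0 <= f x <= C) ->
    rapproximable f.
  move=> mf f0C.
  have mf' : measurable_fun setT (EFin \o f) by exact/measurable_EFinP.
  have f0 x : setT x -> (0 <= (EFin \o f) x)%E.
    by move=> _; rewrite /= lee_fin; case/andP: (f0C x).
  pose g n : T -> R := nnsfun_approx measurableT mf' n.
  have cv x : g ^~ x @ \oo --> f x.
    by have /fine_cvgP[_] := cvg_nnsfun_approx measurableT mf' f0 (x := x) I.
  have nd x : nondecreasing_seq (g ^~ x).
    by move=> m n mn; have /lefP := nd_nnsfun_approx measurableT mf' mn; exact.
  apply: (rapproximable_lim (C := C) (f_ := g)) => //.
    move=> n; set h := nnsfun_approx measurableT mf' n.
    have -> : g n = (fun x =>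
        \sum_(y <- finmap.enum_fset (fset_set (range h))) (y * \1_(h @^-1` [set y]) x)).
      apply/funext => x; rewrite /g fimfunE fsbig_finite //=; exact: fimfunP.
    apply: rapproximable_sum => y; apply: rapproximableM; first exact: rapproximable_cst.
    by apply: aE; rewrite -[_ @^-1` _]setTI; exact: measurable_funP.
  move=> n x; rewrite ger0_norm; last exact: fun_ge0.
  apply: (@le_trans _ _ (f x)); last by case/andP: (f0C x).
  rewrite -(cvg_lim (@Rhausdorff R) (cv x)); apply: nondecreasing_cvgn_le.
    exact: nd.
  by apply/cvg_ex; exists (f x).
have areal (f : T -> R) C : measurable_fun setT f -> (forall x, `|f x| <= C) ->
    rapproximable f.
  move=> mf fC; have -> : f = (fun x => (f x + C) + - C).
    by apply/funext => x; rewrite addrK.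
  apply: rapproximableD; last exact: rapproximable_cst.
  apply: (apos _ (C + C)).
    by apply: measurable_funD => //; exact: measurable_cst.
  by move=> x; have := fC x; rewrite ler_norml => /andP[] ? ?; apply/andP; split; lra.
move=> f mf [C fC]; have [m1 m2] := mf.
have [_ _ a1] := areal _ _ m1 (fun x => (normr_sqmod (fC x)).1).
have [_ _ a2] := areal _ _ m2 (fun x => (normr_sqmod (fC x)).2).
have -> : f = (fun x => (complex.Re (f x))%:C%C + 'i%C * (complex.Im (f x))%:C%C).
  by apply/funext => x; rewrite -complexE.
have c1 := cmeasurable_real m1; have c2 := cmeasurable_real m2.
have ci : cmeasurable (fun _ : T => 'i%C : R[i]) by exact: cmeasurable_cst.
apply: (approximableD c1 (cmeasurableM ci c2) a1).
apply: (approximableM ci c2) => //.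
- exact: (cbounded_real (fun x => (normr_sqmod (fC x)).2)).
- by apply: approximable_test; exact: (test_cst algP).
Qed.

End Approximation.

(** * A quadratic functional of the multiplier *)

Section QuadraticFunctional.
Context d (T : measurableType d) (R : realType).
Variable mu : {measure set T -> \bar R}.
Implicit Types (b m p : T -> R[i]) (h : T -> R).
Local Notation rint f := (mu.-integrable setT (EFin \o f)).

Lemma measurable_invr (h : T -> R) : measurable_fun setT h ->
  measurable_fun setT (fun x => (h x)^-1).
Proof.
move=> mh.
have -> : (fun x => (h x)^-1) =
    (fun x => if 0 <= h x then h x `^ (-1) else - (- h x) `^ (-1)).
  apply/funext => x; case: leP => h0; first by rewrite powR_inv1.
  by rewrite powR_inv1 ?invrN ?opprK // oppr_ge0 ltW.
apply: measurable_fun_ifT.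
- by apply: measurable_fun_ler => //; exact: measurable_cst.
- have := measurableT_comp (@measurable_powR R (-1)) mh; exact.
- apply: measurable_funN.
  have := measurableT_comp (@measurable_powR R (-1)) (measurable_funN mh); exact.
Qed.

(** For b = [v, th], h = [th, th] and m a trigonometric polynomial, the integral
    of this density is 2 Re <v, w> - |w|^2, where w is the combination of the
    orbit of th with the coefficients of m.  That number says how well w
    approximates v, but the integral makes sense for every bounded measurable
    m. *)
Definition quad_density (b m : R[i]) (h : R) : R :=
  2 * complex.Re (b * m^*) - sqmod m * h.

Lemma quad_densityE (b m : R[i]) (h : R) : quad_density b m h =
  2 * (complex.Re b * complex.Re m + complex.Im b * complex.Im m) - sqmod m * h.
Proof. by rewrite /quad_density !Re_Im; congr (_ - _); ring. Qed.

(** Young's inequality on the cross terms: the first error term is small because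
    of de, the second because p approximates m in L^2(w). *)
Lemma quad_density_le (de M h w : R) (b m p : R[i]) : 0 < de -> sqmod m <= M ->
  w = `|complex.Re b| + `|complex.Im b| + `|h| ->
  quad_density b m h <= quad_density b p h +
    (de * (1 + M) * w + (de^-1 + 1) * (sqmod (m - p) * w)).
Proof.
move=> de0 mM wE; set e := de^-1.
have e0 : 0 < e by rewrite invr_gt0.
have ed : e * de = 1 by rewrite mulVf // gt_eqF.
have amgm (y : R) : `|2 * y| <= de + e * y ^+ 2.
  have -> : `|2 * y| = 2 * `|y| by rewrite normrM ger0_norm.
  rewrite -(real_normK (num_real y)) -subr_ge0.
  have -> : de + e * `|y| ^+ 2 - 2 * `|y| = e * (de - `|y|) ^+ 2.
    rewrite sqrrB; have -> : e * (de ^+ 2 - de * `|y| *+ 2 + `|y| ^+ 2) =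
      (e * de) * de - (e * de) * (`|y| *+ 2) + e * `|y| ^+ 2 by ring.
    by rewrite ed; ring.
  by rewrite mulr_ge0 ?sqr_ge0 // ltW.
have lin (x y : R) : 2 * (x * y) <= `|x| * (de + e * y ^+ 2).
  rewrite mulrCA (le_trans (ler_norm _)) // normrM ler_wpM2l //; exact: amgm.
set D := m - p; have eD : p = m - D by rewrite /D opprB addrC subrK.
clearbody D.
set x1 := complex.Re b; set x2 := complex.Im b.
set d1 := complex.Re D; set d2 := complex.Im D.
set m1 := complex.Re m; set m2 := complex.Im m.
have cross : - h * (2 * (m1 * d1 + m2 * d2) - sqmod D) <=
    `|h| * (de * M + (e + 1) * sqmod D).
  rewrite (le_trans (ler_norm _)) // normrM normrN ler_wpM2l //.
  rewrite (le_trans (ler_normB _ _)) // (ger0_norm (sqmod_ge0 _)).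
  suff : `|2 * (m1 * d1 + m2 * d2)| <= de * sqmod m + e * sqmod D.
    have : de * sqmod m <= de * M by rewrite ler_pM2l.
    lra.
  have half (x y : R) : `|2 * (x * y)| <= de * x ^+ 2 + e * y ^+ 2.
    have id1 s : de * x ^+ 2 + e * y ^+ 2 + s * (2 * (x * y)) =
        e * (de * x + s * y) ^+ 2 + (1 - s ^+ 2) * (e * y ^+ 2).
      have -> : e * (de * x + s * y) ^+ 2 + (1 - s ^+ 2) * (e * y ^+ 2) =
        (e * de) * (de * x ^+ 2) + (e * de) * (2 * s * (x * y)) + e * y ^+ 2 by ring.
      by rewrite ed; ring.
    have ge0 s : s ^+ 2 = 1 -> 0 <= de * x ^+ 2 + e * y ^+ 2 + s * (2 * (x * y)).
      by move=> s1; rewrite id1 s1 subrr mul0r addr0 mulr_ge0 ?sqr_ge0 // ltW.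
    have := ge0 1 (expr1n _ _); have := ge0 (-1) (sqrr_sign _ 1%N).
    by rewrite ler_norml => ? ?; apply/andP; split; lra.
  rewrite mulrDr (le_trans (ler_normD _ _)) // !sqmodE -/m1 -/m2 -/d1 -/d2.
  by have := half m1 d1; have := half m2 d2; lra.
have l1 := lin x1 d1; have l2 := lin x2 d2.
have step : quad_density b m h - quad_density b p h =
   2 * (x1 * d1) + 2 * (x2 * d2) + - h * (2 * (m1 * d1 + m2 * d2) - sqmod D).
  rewrite eD !quad_densityE !sqmodE !Re_Im -/x1 -/x2 -/m1 -/m2 -/d1 -/d2.
  clearbody d1 d2 x1 x2 m1 m2; ring.
have sD : sqmod D = d1 ^+ 2 + d2 ^+ 2 by rewrite sqmodE.
have d1D : d1 ^+ 2 <= sqmod D by rewrite sD lerDl sqr_ge0.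
have d2D : d2 ^+ 2 <= sqmod D by rewrite sD lerDr sqr_ge0.
have M0 : 0 <= M by rewrite (le_trans (sqmod_ge0 _) mM).
have up (y : R) : y ^+ 2 <= sqmod D ->
    de + e * y ^+ 2 <= de * (1 + M) + (e + 1) * sqmod D.
  move=> yD; have : e * y ^+ 2 <= e * sqmod D by rewrite ler_pM2l.
  have : 0 <= de * M by rewrite mulr_ge0 // ltW.
  have := sqmod_ge0 D; lra.
have u1 : `|x1| * (de + e * d1 ^+ 2) <= `|x1| * (de * (1 + M) + (e + 1) * sqmod D).
  by rewrite ler_wpM2l // up.
have u2 : `|x2| * (de + e * d2 ^+ 2) <= `|x2| * (de * (1 + M) + (e + 1) * sqmod D).
  by rewrite ler_wpM2l // up.
have u3 : `|h| * (de * M + (e + 1) * sqmod D) <= `|h| * (de * (1 + M) + (e + 1) * sqmod D).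
  by rewrite ler_wpM2l //; lra.
rewrite -lerBlDl step.
have -> : de * (1 + M) * w + (e + 1) * (sqmod D * w) =
  (`|x1| + `|x2| + `|h|) * (de * (1 + M) + (e + 1) * sqmod D) by rewrite wE -/x1 -/x2; ring.
by rewrite !mulrDl; lra.
Qed.

Definition quad b h m : R :=
  Rintegral mu setT (fun x => quad_density (b x) (m x) (h x)).

Lemma rint_quad b h m : cintegrable mu b -> rint h -> cmeasurable m -> cbounded m ->
  rint (fun x => quad_density (b x) (m x) (h x)).
Proof.
move=> ib ih mm bm; have [C mC] := bm.
apply: rintB; first apply: rintZ.
  by have [] := cintegrableM ib (cmeasurableJ mm) (cboundedJ bm).
under [X in EFin \o X]eq_fun do rewrite mulrC.
apply: (rintM (C := C) ih (measurable_sqmod mm)) => x.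
by rewrite ger0_norm // sqmod_ge0.
Qed.

Section Dense.
Variables (P : set (T -> R[i])) (algP : test_algebra P).
Hypothesis denseP : forall w : T -> R, (forall x, 0 <= w x) -> rint w ->
  forall f, cmeasurable f -> cbounded f -> approximable mu P w f.

Lemma quad_approx b h m (e : R) : cintegrable mu b -> rint h ->
  cmeasurable m -> cbounded m -> 0 < e ->
  exists p, P p /\ quad b h m <= quad b h p + e.
Proof.
move=> ib ih mm bm e0; have [M mM] := bm.
have [i1 i2] := ib.
pose w x := `|complex.Re (b x)| + `|complex.Im (b x)| + `|h x|.
have w0 x : 0 <= w x by rewrite !addr_ge0.
have iw : rint w.
  by apply: rintD; [apply: rintD|]; exact: integrable_norm.
pose W := Rintegral mu setT w.
have W0 : 0 <= W by apply: Rintegral_ge0.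
(* [de] takes care of the total mass of the weight, and then [e'] of the
   remaining squared distance; the increments by 1 only ensure positivity. *)
pose K := (1 + `|M|) * (W + 1).
have K0 : 0 < K by rewrite mulr_gt0 // ltr_wpDl // ltr_wpDr.
pose de := (e / 2) / K.
have de0 : 0 < de by rewrite !divr_gt0.
have k0 : 0 < de^-1 + 1 by rewrite addr_gt0 // invr_gt0.
pose e' := (e / 2) / (de^-1 + 1).
have e'0 : 0 < e' by rewrite !divr_gt0.
have [p [Pp dp]] := denseP w0 iw mm bm e'0.
exists p; split => //.
have mp := test_measurable algP Pp; have bp := test_bounded algP Pp.
have md := measurable_wdist iw mm mp.
have ge0d x : 0 <= sqmod (m x - p x) * w x by rewrite mulr_ge0 ?sqmod_ge0.
have id : rint (fun x => sqmod (m x - p x) * w x).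
  by apply/rint_ge0P => //; rewrite (lt_trans dp) // ltry.
have dp' : Rintegral mu setT (fun x => sqmod (m x - p x) * w x) < e'.
  by rewrite -lte_fin -rint_intE.
have iq := rint_quad ib ih mp bp.
have iww : rint (fun x => de * (1 + M) * w x) by exact: rintZ.
have idd : rint (fun x => (de^-1 + 1) * (sqmod (m x - p x) * w x)) by exact: rintZ.
have ier := rintD iww idd.
apply: (@le_trans _ _ (Rintegral mu setT (fun x => quad_density (b x) (p x) (h x) +
   (de * (1 + M) * w x + (de^-1 + 1) * (sqmod (m x - p x) * w x))))).
  apply: le_Rintegral => //; [exact: rint_quad|exact: rintD|].
  by move=> x _; exact: quad_density_le.
rewrite RintegralD // -/(quad b h p) lerD2l RintegralD // !RintegralZl //.
have h1 : de * (1 + M) * W <= e / 2.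
  have -> : e / 2 = de * K by rewrite /de divfK // gt_eqF.
  rewrite -mulrA ler_pM2l // /K ler_pM //.
  - by have := mM point; have := sqmod_ge0 (m point); lra.
  - by rewrite lerD2l ler_norm.
  - by rewrite lerDl.
have h2 : (de^-1 + 1) * Rintegral mu setT (fun x => sqmod (m x - p x) * w x) <= e / 2.
  have -> : e / 2 = (de^-1 + 1) * e' by rewrite [RHS]mulrC /e' divfK // gt_eqF.
  by rewrite ler_pM2l // ltW.
by rewrite [leRHS]splitr lerD.
Qed.

(** By density, the squared modulus of a test function may be replaced by the
    indicator of the set where h is negative. *)
Lemma ae_ge0_of_tests h : rint h ->
  (forall p, P p -> 0 <= Rintegral mu setT (fun x => sqmod (p x) * h x)) ->
  {ae mu, forall x, 0 <= h x}.
Proof.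
move=> ih posP; apply: ae_ge0_of_integral => //.
set N := [set y | h y < 0].
have mN : measurable N.
  by apply: measurable_set_lt; [exact: (rint_measurable ih)|exact: measurable_cst].
pose m x : R[i] := (\1_N x)%:C%C.
have mm : cmeasurable m by apply: cmeasurable_real; exact: measurable_indic.
have bm : cbounded m.
  apply: (@cbounded_real _ _ _ _ 1) => x.
  by rewrite indicE; case: (_ \in _); rewrite ?normr1 ?normr0.
have quad0 p : cmeasurable p -> cbounded p -> quad (fun=> 0) h p =
    - Rintegral mu setT (fun x => sqmod (p x) * h x).
  move=> mp [C pC]; rewrite -mulN1r -RintegralZl //; last first.
    under [X in EFin \o X]eq_fun do rewrite mulrC.
    apply: (rintM (C := C) ih (measurable_sqmod mp)) => x.
    by rewrite ger0_norm // sqmod_ge0.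
  by apply: eq_Rintegral => x _; rewrite /quad_density mul0r /=; ring.
have -> : Rintegral mu setT (fun x => \1_N x * h x) =
    Rintegral mu setT (fun x => sqmod (m x) * h x).
  apply: eq_Rintegral => x _; rewrite sqmod_real indicE.
  by case: (_ \in _); rewrite ?expr1n ?expr0n.
have qm : quad (fun=> 0) h m <= 0.
  apply/ler_addgt0Pl => e e0; rewrite addr0.
  have [p [Pp le]] := quad_approx (cintegrable0 mu) ih mm bm e0.
  apply: (le_trans le); rewrite quad0; [|exact: test_measurable Pp|exact: test_bounded Pp].
  by have := posP p Pp; lra.
by move: qm; rewrite quad0 // oppr_le0.
Qed.

Variables (b : T -> R[i]) (h : T -> R) (ib : cintegrable mu b) (ih : rint h).
Hypothesis h_ge0 : {ae mu, forall x, 0 <= h x}.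

Let mb := cintegrable_measurable ib.
Let mh := rint_measurable ih.
Let msb := measurable_sqmod mb.

(** On the set where h <= 0 a multiplier r b, with b truncated, makes the functional at least
    2 r times the integral of |b|^2, which stays bounded in r only if b vanishes
    there. *)
Lemma ae_eq0_of_quad_le (K : R) : (forall p, P p -> quad b h p <= K) ->
  {ae mu, forall x, h x <= 0 -> b x = 0}.
Proof.
move=> leK.
have leKm m : cmeasurable m -> cbounded m -> quad b h m <= K.
  move=> mm bm; apply/ler_addgt0Pr => e e0.
  have [p [Pp le]] := quad_approx ib ih mm bm e0.
  by apply: (le_trans le); rewrite lerD2r; exact: leK.
pose E n : set T := [set x | h x <= 0] `&` [set x | sqmod (b x) <= n%:R].
have mE n : measurable (E n).
  by apply: measurableI; apply: measurable_set_le => //; exact: measurable_cst.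
suff H n : {ae mu, forall x, E n x -> b x = 0}.
  have := ae_foralln H; apply: filterS => x Hx hx.
  apply: (Hx (Num.truncn (sqmod (b x))).+1); split => //=.
  by rewrite ltW // truncnS_gt.
pose g x : R := \1_(E n) x * sqmod (b x).
have g0 x : 0 <= g x by rewrite mulr_ge0 ?sqmod_ge0 // indicE; case: (_ \in _).
have mg : measurable_fun setT g by apply: measurable_funM => //; exact: measurable_indic.
pose m1 x : R[i] := (\1_(E n) x)%:C%C * b x.
have mm1 : cmeasurable m1.
  by apply: cmeasurableM => //; apply: cmeasurable_real; exact: measurable_indic.
have bm1 : cbounded m1.
  exists n%:R => x; rewrite sqmodM sqmod_real indicE.
  case: (boolP (x \in E n)) => [|_]; last by rewrite expr0n mul0r ler0n.
  by rewrite inE => -[_ ?]; rewrite expr1n mul1r.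
have ig : rint g.
  have [i1 _] := cintegrableM ib (cmeasurableJ mm1) (cboundedJ bm1).
  apply: eq_integrable i1 => // x _ /=; congr EFin.
  by rewrite /g /m1 sqmodE !Re_Im /=; ring.
have qle r : 0 < r -> 2 * r * Rintegral mu setT g <= K.
  move=> r0; pose m x : R[i] := (r%:C)%C * m1 x.
  have mm : cmeasurable m by apply: cmeasurableM => //; exact: cmeasurable_cst.
  have bm : cbounded m by apply: cboundedM => //; exact: cbounded_cst.
  apply: le_trans (leKm m mm bm); rewrite -RintegralZl //.
  apply: le_Rintegral => //; [exact: rintZ|exact: rint_quad|].
  move=> x _; rewrite quad_densityE /m /m1 /g !sqmodM !sqmod_real !Re_Im /=.
  have [->|[-> hx]] : \1_(E n) x = 0 :> R \/ \1_(E n) x = 1 :> R /\ h x <= 0.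
  - rewrite indicE; case: (boolP (x \in E n)) => [|_]; last by left.
    by rewrite inE => -[hx _]; right; split.
  - by lra.
  rewrite sqmodE; set u := complex.Re (b x); set v := complex.Im (b x).
  have : 0 <= r ^+ 2 * (u ^+ 2 + v ^+ 2) * - h x.
    rewrite mulr_ge0 ?oppr_ge0 // mulr_ge0 ?sqr_ge0 //.
    by rewrite addr_ge0 ?sqr_ge0.
  lra.
have Ig0 : Rintegral mu setT g = 0.
  have I0 : 0 <= Rintegral mu setT g by apply: Rintegral_ge0 => x _; apply: g0.
  apply/eqP; rewrite eq_le I0 andbT leNgt; apply/negP => Ig.
  have := qle ((`|K| + 1) / Rintegral mu setT g).
  rewrite divr_gt0 ?ltr_wpDl // => /(_ isT).
  rewrite -mulrA divfK ?gt_eqF // leNgt => /negP; apply.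
  by have := ler_norm K; have := normr_ge0 K; lra.
have : (\int[mu]_x `|(g x)%:E| = 0)%E.
  under eq_integral do rewrite /= ger0_norm//.
  by rewrite rint_intE // Ig0.
have mg' : measurable_fun setT (EFin \o g) by apply/measurable_EFinP.
move/ae_eq_integral_abs => /(_ measurableT) /(_ mg').
apply: filterS => x /(_ I) [] /= /eqP gx Ex.
by move: gx; rewrite /g indicE mem_set // mul1r sqmod_eq0 => /eqP.
Qed.

Definition quotient_density x : R := sqmod (b x) * (h x)^-1.

Lemma measurable_quotient_density : measurable_fun setT quotient_density.
Proof. by apply: measurable_funM => //; exact: measurable_invr. Qed.

(** The optimal multiplier b/h, truncated to become bounded, attains values as
    close to the integral of |b|^2/h as desired. *)
Lemma quad_sup (N : R) :
  (N%:E < \int[mu]_x (Num.max 0 (quotient_density x))%:E)%E ->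
  exists p, P p /\ N < quad b h p.
Proof.
move=> ltN.
pose E n : set T := [set x | n.+1%:R^-1 <= h x] `&` [set x | sqmod (b x) <= n%:R].
have mE n : measurable (E n).
  by apply: measurableI; apply: measurable_set_le => //; exact: measurable_cst.
have hE n x : E n x -> 0 < h x.
  by move=> [/= ? _]; apply: (@lt_le_trans _ _ n.+1%:R^-1); rewrite // invr_gt0 ltr0n.
pose q n x := \1_(E n) x * quotient_density x.
have mq n : measurable_fun setT (q n).
  by apply: measurable_funM; [exact: measurable_indic|exact: measurable_quotient_density].
have q0 n x : 0 <= q n x.
  rewrite /q indicE; case: (boolP (x \in E n)); last by rewrite mul0r.
  by rewrite inE => /hE hx; rewrite mul1r mulr_ge0 ?sqmod_ge0 // invr_ge0 ltW.
pose m n x : R[i] := (\1_(E n) x * (h x)^-1)%:C%C * b x.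
have mm n : cmeasurable (m n).
  apply: cmeasurableM => //; apply: cmeasurable_real; apply: measurable_funM.
    exact: measurable_indic.
  exact: measurable_invr.
have bm n : cbounded (m n).
  exists (n.+1%:R ^+ 2 * n%:R) => x; rewrite /m sqmodM sqmod_real indicE.
  case: (boolP (x \in E n)); last by rewrite mul0r expr0n mul0r mulr_ge0 ?ler0n.
  rewrite inE => Ex; have hx := hE _ _ Ex; case: Ex => /= hn bn.
  rewrite mul1r ler_pM ?sqr_ge0 ?sqmod_ge0 // ler_sqr ?nnegrE ?ler0n ?invr_ge0 ?(ltW hx) //.
  by rewrite -(invrK n.+1%:R) lef_pV2 // posrE // invr_gt0 ltr0n.
have eq_q n x : quad_density (b x) (m n x) (h x) = q n x.
  rewrite quad_densityE /m /q /quotient_density sqmodM sqmod_real !Re_Im /= indicE.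
  case: (boolP (x \in E n)) => [|_]; last by rewrite /= expr2 !mul0r; ring.
  rewrite inE => /hE hx; have h0 : h x != 0 by rewrite gt_eqF.
  by rewrite sqmodE /=; field.
have iq n : rint (q n).
  have := rint_quad ib ih (mm n) (bm n).
  by under [X in EFin \o X]eq_fun do rewrite eq_q.
have cq : (fun n => \int[mu]_x (q n x)%:E)%E @ \oo -->
    (\int[mu]_x (Num.max 0 (quotient_density x))%:E)%E.
  have lim x : (fun n => (q n x)%:E) @ \oo --> (Num.max 0 (quotient_density x))%:E.
    apply: cvg_near_cst; near=> n; congr EFin; rewrite /q indicE.
    have [hx|hx] := ltP 0 (h x).
      rewrite mem_set ?mul1r.
        by rewrite max_r // mulr_ge0 ?sqmod_ge0 // invr_ge0 ltW.
      split => /=.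
        rewrite -[h x]invrK lef_pV2 ?posrE ?invr_gt0 ?ltr0n // ltW //.
        apply: (lt_le_trans (truncnS_gt _)); rewrite ler_nat ltnS; near: n.
        exact: nbhs_infty_ge.
      rewrite ltW //; apply: (lt_le_trans (truncnS_gt _)); rewrite ler_nat; near: n.
      exact: nbhs_infty_gt.
    rewrite memNset ?mul0r; last by move=> /hE; rewrite ltNge hx.
    by rewrite max_l // mulr_ge0_le0 ?sqmod_ge0 // invr_le0.
  have := @cvg_monotone_convergence _ _ _ mu setT measurableT
    (fun n x => (q n x)%:E) _ _ _.
  rewrite (_ : (fun x => limn (fun n => (q n x)%:E)) =
    (fun x => (Num.max 0 (quotient_density x))%:E)); last first.
    by apply/funext => x; apply/cvg_lim => //; exact: lim.
  apply.
  - by move=> n; apply/measurable_EFinP; exact: mq.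
  - by move=> n x _; rewrite lee_fin; exact: q0.
  - move=> x _ k n kn; rewrite lee_fin /q !indicE.
    case: (boolP (x \in E k)); last first.
      by move=> _; rewrite mul0r; have := q0 n x; rewrite /q indicE.
    rewrite inE => -[/= hk bk]; rewrite mem_set //; split => /=.
      by apply: le_trans hk; rewrite lef_pV2 ?posrE ?ltr0n // ler_nat ltnS.
    by apply: (le_trans bk); rewrite ler_nat.
have [n ltn] : exists n, (N%:E < \int[mu]_x (q n x)%:E)%E.
  apply: contrapT => /forallNP nlt; move: ltN.
  rewrite ltNge => /negP; apply; rewrite -(cvg_lim _ cq) //.
  apply: lime_le; first by apply/cvg_ex; eexists; exact: cq.
  by near=> n; rewrite leNgt; apply/negP; exact: nlt.
move: ltn; rewrite rint_intE // lte_fin => ltn.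
have e0 : 0 < (Rintegral mu setT (q n) - N) / 2 by rewrite divr_gt0 // subr_gt0.
have [p [Pp le]] := quad_approx ib ih (mm n) (bm n) e0.
exists p; split => //.
have : quad b h (m n) = Rintegral mu setT (q n) by apply: eq_Rintegral => x _; rewrite eq_q.
by lra.
Unshelve. all: by end_near. Qed.

(** Completing the square: no multiplier exceeds the integral of |b|^2/h. *)
Lemma quad_le_quotient p : {ae mu, forall x, h x <= 0 -> b x = 0} ->
  cmeasurable p -> cbounded p ->
  ((quad b h p)%:E <= \int[mu]_x (Num.max 0 (quotient_density x))%:E)%E.
Proof.
move=> b0 mp bp.
have iq := rint_quad ib ih mp bp.
have mq := rint_measurable iq.
have mm : measurable_fun setT (fun x => Num.max 0 (quad_density (b x) (p x) (h x))).
  by apply: measurable_maxr => //; exact: measurable_cst.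
rewrite -rint_intE //.
apply: (@le_trans _ _ (\int[mu]_x (Num.max 0 (quad_density (b x) (p x) (h x)))%:E)%E).
  apply: le_integral => //.
    apply: (@rint_le _ _ _ _ _ (fun x => `|quad_density (b x) (p x) (h x)|)) => //.
      by move=> x; rewrite ger0_norm ?le_max ?lexx // ge_max normr_ge0 ler_norm.
    exact: integrable_norm.
  by move=> x _; rewrite lee_fin le_max lexx orbT.
apply: ae_ge0_le_integral => //.
- by move=> x _; rewrite lee_fin le_max lexx.
- exact/measurable_EFinP.
- by move=> x _; rewrite lee_fin le_max lexx.
- apply/measurable_EFinP; apply: measurable_maxr; first exact: measurable_cst.
  exact: measurable_quotient_density.
apply: filterS2 h_ge0 b0 => x hx bx _; rewrite lee_fin ge_max le_max lexx /=.
rewrite le_max; apply/orP; right.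
rewrite /quotient_density quad_densityE.
have [h0|h0] := eqVneq (h x) 0.
  by rewrite h0 invr0 bx ?h0 //= !mul0r !mulr0 addr0 mulr0 subr0.
have hp : 0 < h x by rewrite lt_def h0.
rewrite -subr_ge0 !sqmodE.
set b1 := complex.Re (b x); set b2 := complex.Im (b x).
set p1 := complex.Re (p x); set p2 := complex.Im (p x).
have -> : (b1 ^+ 2 + b2 ^+ 2) / h x -
  (2 * (b1 * p1 + b2 * p2) - (p1 ^+ 2 + p2 ^+ 2) * h x) =
  ((b1 - h x * p1) ^+ 2 + (b2 - h x * p2) ^+ 2) / h x by field.
by rewrite divr_ge0 ?addr_ge0 ?sqr_ge0 // ltW.
Qed.

End Dense.

End QuadraticFunctional.

(** * The dual of a countable discrete group *)

Section Characters.
Variables (R : realType) (G : topologicalZmodType).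
Hypothesis second_countableG : @second_countable G.
Hypothesis discreteG : forall U : set G, open U.
Local Notation Ghat := (borel (dual R G)).

Definition ev (x : G) (a : Ghat) : R[i] := (a : dual R G) x.

Lemma sqmod_ev x a : sqmod (ev x a) = 1.
Proof. by apply: sqmod_norm; exact: dual_norm. Qed.

Lemma evD x y a : ev (x + y) a = ev x a * ev y a.
Proof. exact: dual_morph. Qed.

Lemma ev0 a : ev 0 a = 1.
Proof.
have a0 : ev 0 a != 0 by rewrite -sqmod_eq0 sqmod_ev oner_neq0.
by apply: (mulfI a0); rewrite -evD addr0 mulr1.
Qed.

Lemma evN x a : ev (- x) a = (ev x a)^*.
Proof.
have a0 : ev x a != 0 by rewrite -sqmod_eq0 sqmod_ev oner_neq0.
by apply: (mulfI a0); rewrite -evD subrr ev0 mulJ sqmod_ev.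
Qed.

Lemma countable_discrete : countable [set: G].
Proof.
have [B cB [oB bB]] := second_countableG.
apply: (@sub_countable _ _ _ [set xget 0 U | U in B]).
  apply: subset_card_le => x _.
  have [U [BU Ux] Usub] : filter_from [set U | B U /\ U x] id [set x].
    by apply: bB; apply: open_nbhs_nbhs; split => //; exact: discreteG.
  exists U => //; have : U (xget 0 U) by apply: xgetPex; exists x.
  by move=> /Usub.
exact: (card_le_trans (card_image_le _ _) cB).
Qed.

(** The sets that are cofinite in an infinite set form a proper filter, which
    has no cluster point in a discrete space. *)
Lemma discrete_compact_finite (K : set G) : compact K -> finite_set K.
Proof.
move=> cK; apply: contrapT => infK.
pose F : set_system G := [set A | finite_set (K `\` A)].
have FF : ProperFilter F.
  split; first by rewrite /F /= setD0.
  split.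
  - by rewrite /F /= setDT; exact: finite_set0.
  - by move=> A B FA FB; rewrite /F /= setDIr finite_setU.
  - by move=> A B AB; apply: sub_finite_set; exact: setDS.
have [|p [Kp clp]] := cK F FF; first by rewrite /F /= setDv; exact: finite_set0.
have np : nbhs p [set p] by apply: open_nbhs_nbhs; split => //; exact: discreteG.
have Fp : F (~` [set p]).
  rewrite /F /= setDE setCK; apply: (sub_finite_set (@subIsetr _ _ _)).
  exact: finite_set1.
by have [x [/= xp /xp]] := clp _ _ Fp np.
Qed.

Lemma open_ev (x : G) (O : set R[i]^o) : open O -> open [set a : dual R G | O (a x)].
Proof.
move=> oO; exists [set g : {compact-open, G -> R[i]^o} | g @` [set x] `<=` O].
  by apply: compact_open_open => //; exact: compact_set1.
apply/seteqP; split => a /=; first by apply; exists x.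
by move=> Oax _ [_ -> <-].
Qed.

Definition half_plane (c : R[i]) (x : G) (r : R) : set Ghat :=
  [set a | r < complex.Re (c * ev x a)].

Lemma open_Re_gt (c : R[i]) (r : R) :
  open [set z : R[i]^o | r < complex.Re (c * z)].
Proof.
rewrite openE => z /= rz.
set s := complex.Re (c * z) - r; have s0 : 0 < s by rewrite subr_gt0.
pose k := sqmod c + 1; have k0 : 0 < k by rewrite ltr_wpDl ?sqmod_ge0.
pose e := s / k; have e0 : 0 < e by rewrite divr_gt0.
apply/nbhs_ballP; exists (e%:C)%C => /=; first by rewrite ltcR.
move=> y; rewrite -ball_normE /= => zy.
move: zy; rewrite normc_lt_sqmod // => dzy.
have -> : c * y = c * z - c * (z - y) by ring.
rewrite ReD ReN.
suff : complex.Re (c * (z - y)) < s by rewrite /s; lra.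
set t := complex.Re _.
have t2 : t ^+ 2 < s ^+ 2.
  apply: (@le_lt_trans _ _ (sqmod (c * (z - y)))).
    by rewrite sqmodE lerDl sqr_ge0.
  rewrite sqmodM; apply: (@le_lt_trans _ _ (k ^+ 2 * sqmod (z - y))).
    rewrite ler_wpM2r ?sqmod_ge0 // /k; have := sqmod_ge0 c; nra.
  have -> : s ^+ 2 = k ^+ 2 * e ^+ 2 by rewrite -exprMn mulrC divfK // gt_eqF.
  by rewrite ltr_pM2l // exprn_gt0.
by rewrite (le_lt_trans (ler_norm t)) // -(gtr0_norm s0) -ltr_sqr ?nnegrE // !real_normK // num_real.
Qed.

Lemma measurable_Re_ev (c : R[i]) (x : G) :
  measurable_fun setT (fun a : Ghat => complex.Re (c * ev x a)).
Proof.
apply: (measurability _ (RGenOInfty.measurableE R)) => //.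
move=> /= _ [_ [r ->] <-]; rewrite setTI.
apply: sub_sigma_algebra.
have -> : (fun a : Ghat => complex.Re (c * ev x a)) @^-1` `]r, +oo[ =
    [set a : dual R G | [set z : R[i]^o | r < complex.Re (c * z)] (a x)].
  by apply/seteqP; split => a /=; rewrite in_itv /= andbT.
exact/open_ev/open_Re_gt.
Qed.

Lemma cmeasurable_ev x : cmeasurable (ev x).
Proof.
split.
  have := measurable_Re_ev 1 x; by under eq_fun do rewrite mul1r.
(* Im z = Re (- i z) *)
have := measurable_Re_ev (- 'i%C) x.
by under eq_fun do rewrite !Re_Im /= oppr0 mul0r sub0r mulN1r opprK.
Qed.

Lemma cbounded_ev x : cbounded (ev x).
Proof. by exists 1 => a; rewrite sqmod_ev. Qed.

(** The values 1, -1, i and -i of c bound the real and imaginary parts of a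
    character from both sides. *)
Definition half_planes : set (set Ghat) :=
  [set E | exists c x r, sqmod c = 1 /\ E = half_plane c x r].

(** A countable family of neighbourhoods, [e] being an enumeration of the
    group. *)
Definition rational_nbhd (e : nat -> G) (s : seq (nat * (rat * rat))) (n : nat) :
    set Ghat :=
  [set a | forall k, k \in s ->
    `|complex.Re (ev (e k.1) a) - ratr k.2.1| < n.+1%:R^-1 /\
    `|complex.Im (ev (e k.1) a) - ratr k.2.2| < n.+1%:R^-1].

Lemma rational_nbhd_generated e s n :
  smallest (sigma_algebra setT) half_planes (rational_nbhd e s n).
Proof.
suff : @measurable _ (g_sigma_algebraType half_planes) (rational_nbhd e s n) by [].
elim: s => [|k s IH].
  rewrite (_ : rational_nbhd _ _ _ = setT); first exact: measurableT.
  by apply/seteqP; split => // a _ k; rewrite in_nil.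
have hp c x r : sqmod c = 1 ->
    @measurable _ (g_sigma_algebraType half_planes) (half_plane c x r).
  by move=> c1; apply: sub_sigma_algebra; exists c, x, r.
have s1 : sqmod (1 : R[i]) = 1 by exact: sqmod1.
have sN1 : sqmod (-1 : R[i]) = 1 by rewrite sqmodN sqmod1.
have si : sqmod ('i%C : R[i]) = 1 by rewrite sqmodE /= expr0n add0r expr1n.
have sNi : sqmod (- 'i%C : R[i]) = 1 by rewrite sqmodN.
set x := e k.1; set d := n.+1%:R^-1 : R.
have -> : rational_nbhd e (k :: s) n =
    ((half_plane 1 x (ratr k.2.1 - d) `&` half_plane (-1) x (- (ratr k.2.1 + d))) `&`
    (half_plane (- 'i%C) x (ratr k.2.2 - d) `&` half_plane 'i%C x (- (ratr k.2.2 + d)))) `&`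
    rational_nbhd e s n.
  apply/seteqP; split => a /=.
    move=> H; have [] := H k (mem_head _ _).
    rewrite -/x -/d !ltr_norml => /andP[? ?] /andP[? ?]; split.
      by rewrite /half_plane /= !Re_Im /=; split; split; lra.
    by move=> j js; apply: H; rewrite inE js orbT.
  move=> [[[]]]; rewrite /half_plane /= !Re_Im /= => h1 h2 [h3 h4] H j.
  rewrite inE => /orP[/eqP ->|]; last exact: H.
  by rewrite -/x -/d !ltr_norml; split; apply/andP; split; lra.
by apply: measurableI => //; apply: measurableI; apply: measurableI; exact: hp.
Qed.

Lemma nbhs_close (z : R[i]^o) (O : set R[i]^o) : nbhs z O ->
  exists n, forall y, `|complex.Re y - complex.Re z| < n.+1%:R^-1 ->
    `|complex.Im y - complex.Im z| < n.+1%:R^-1 -> O y.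
Proof.
move=> /nbhs_ballP[e e0 eO].
have [r0 er] : 0 < complex.Re e /\ e = ((complex.Re e)%:C)%C.
  by move: e0 => /=; rewrite ltcE /= => /andP[/eqP ie ->]; split => //;
    apply: complex_eq => //=; rewrite ie.
set r := complex.Re e in r0 er.
exists (Num.truncn (2 / r)) => y y1 y2; apply: eO.
rewrite -ball_normE /= er normc_lt_sqmod // sqmodE !Re_Im.
have n0 : 0 < (Num.truncn (2 / r)).+1%:R^-1 :> R by rewrite invr_gt0 ltr0n.
have nr : (Num.truncn (2 / r)).+1%:R^-1 <= r / 2.
  rewrite -[leRHS]invrK invf_div lef_pV2 ?posrE ?divr_gt0 ?ltr0n //.
  by rewrite ltW // truncnS_gt.
set t := _.+1%:R^-1 in y1 y2 n0 nr.
have sq (u : R) : `|u| < t -> u ^+ 2 <= r ^+ 2 / 4.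
  move=> ut; rewrite -real_normK ?num_real //.
  have : `|u| <= r / 2 by rewrite ltW // (lt_le_trans ut).
  by have := normr_ge0 u; nra.
have := sq _ y1; have := sq _ y2.
have : 0 < r ^+ 2 by rewrite exprn_gt0.
set y1' := complex.Re y; set y2' := complex.Im y; lra.
Qed.

(** Compact subsets of a discrete group are finite, so basic neighbourhoods of
    a character constrain only finitely many of its values. *)
Lemma dual_nbhs (U : set (dual R G)) (a : dual R G) : open U -> U a ->
  exists (X : seq G) n, forall b : dual R G,
    (forall x, x \in X -> `|complex.Re (b x) - complex.Re (a x)| < n.+1%:R^-1 /\
      `|complex.Im (b x) - complex.Im (a x)| < n.+1%:R^-1) -> U b.
Proof.
case=> V oV <- Va.
pose B (i : seq G * nat) : set {compact-open, G -> R[i]^o} :=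
  [set f | forall x, x \in i.1 ->
    `|complex.Re (f x) - complex.Re (a x)| < i.2.+1%:R^-1 /\
    `|complex.Im (f x) - complex.Im (a x)| < i.2.+1%:R^-1].
pose F := filter_from setT B.
have FF : Filter F.
  apply: filter_from_filter; first by exists ([::], 0%N).
  move=> [X n] [Y m] _ _; exists (X ++ Y, maxn n m) => // f Bf.
  have le_inv (i : nat) (u : R) : (i <= maxn n m)%N ->
      u < (maxn n m).+1%:R^-1 -> u < i.+1%:R^-1.
    by move=> im /lt_le_trans; apply; rewrite lef_pV2 ?posrE ?ltr0n // ler_nat ltnS.
  split => x /= xX.
    have [] := Bf x; first by rewrite /= mem_cat xX.
    by move=> /(le_inv _ _ (leq_maxl _ _)) ? /(le_inv _ _ (leq_maxl _ _)).
  have [] := Bf x; first by rewrite /= mem_cat xX orbT.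
  by move=> /(le_inv _ _ (leq_maxr _ _)) ? /(le_inv _ _ (leq_maxr _ _)).
have Fa : F --> (dual_fun a : {compact-open, G -> R[i]^o}).
  apply/compact_open_cvgP => K O /discrete_compact_finite /finite_fsetP[D ->] oO aO.
  have Ox x : [set` D] x -> F [set g | O (g x)].
    move=> xD; have [|n nO] := @nbhs_close (a x) O.
      by apply: open_nbhs_nbhs; split => //; apply: aO; exists x.
    by exists ([:: x], n) => // f /(_ x (mem_head _ _))[? ?]; exact: nO.
  apply: filterS (filter_bigI FF Ox) => g gO _ [x xs <-]; exact: gO.
have : F V by apply: Fa; exact: open_nbhs_nbhs.
by move=> [[X n] _ BV]; exists X, n => b bX; apply: BV.
Qed.

End Characters.

(** * Trigonometric polynomials and Plancherel's identity *)

Section TrigonometricPolynomials.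
Variables (R : realType) (G : topologicalZmodType).
Hypothesis second_countableG : @second_countable G.
Hypothesis discreteG : forall U : set G, open U.
Local Notation Ghat := (borel (dual R G)).
Implicit Types (s t : seq (R[i] * G)).

Lemma rational_near (y c : R) : 0 < c -> exists q : rat, `|y - ratr q| < c.
Proof.
move=> c0; have /rat_in_itvoo[q] : y - c < y + c by lra.
by rewrite in_itv /= => /andP[? ?]; exists q; rewrite ltr_norml; apply/andP; split; lra.
Qed.

(** The group being countable, a character that is an interior point of an open
    set has a neighbourhood described by finitely many rational data inside it;
    so every open set is a countable union of such neighbourhoods. *)
Lemma borel_dual_generated (E : set Ghat) : measurable E ->
  smallest (sigma_algebra setT) (@half_planes R G) E.
Proof.
apply: smallest_sub; first exact: smallest_sigma_algebra.
move=> U oU.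
have [f finj] : exists f : G -> nat, {in setT &, injective f}.
  by have /countable_injP[f ?] := countable_discrete second_countableG discreteG; exists f.
pose e n := xget (0 : G) [set x | f x = n].
have eK x : e (f x) = x.
  have /= : [set y | f y = f x] (e (f x)) by apply: xgetPex; exists x.
  by apply: finj; rewrite ?in_setT.
pose W (i : seq (nat * (rat * rat)) * nat) := @rational_nbhd R G e i.1 i.2.
pose F i : set Ghat := [set a | W i a /\ W i `<=` U].
suff : @measurable _ (g_sigma_algebraType (@half_planes R G)) U by [].
have -> : U = \bigcup_i F i.
  apply/seteqP; split => [a Ua|a [i _ [Wa]]]; last exact.
  have [X [n XU]] := dual_nbhs discreteG oU Ua.
  (* half of the radius goes into the rational approximation of [a] and the
     other half into the size of the rational neighbourhood *)
  have c0 : 0 < (n.+1.*2)%:R^-1 :> R by rewrite invr_gt0 ltr0n double_gt0.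
  pose q1 x := projT1 (cid (rational_near (complex.Re (ev x a)) c0)).
  pose q2 x := projT1 (cid (rational_near (complex.Im (ev x a)) c0)).
  have q1P x : `|complex.Re (ev x a) - ratr (q1 x)| < (n.+1.*2)%:R^-1.
    by rewrite /q1; case: cid.
  have q2P x : `|complex.Im (ev x a) - ratr (q2 x)| < (n.+1.*2)%:R^-1.
    by rewrite /q2; case: cid.
  exists ([seq (f x, (q1 x, q2 x)) | x <- X], (n.+1.*2).-1) => //; split.
    by move=> k /mapP[x _ ->] /=; rewrite eK.
  move=> b Wb; apply: XU => x xX.
  have [] := Wb _ (map_f _ xX); rewrite /= eK.
  have tri (u v z : R) : `|u - z| < (n.+1.*2)%:R^-1 -> `|v - z| < (n.+1.*2)%:R^-1 ->
      `|u - v| < n.+1%:R^-1.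
    have -> : n.+1%:R^-1 = (n.+1.*2)%:R^-1 + (n.+1.*2)%:R^-1 :> R.
      rewrite -muln2 natrM; have : n.+1%:R != 0 :> R by rewrite pnatr_eq0.
      by move: (n.+1%:R) => N N0; field.
    by move: (n.+1.*2%:R^-1) => d; rewrite !ltr_norml => /andP[? ?] /andP[? ?];
      apply/andP; split; lra.
  by move=> h1 h2; split; [exact: tri h1 (q1P x)|exact: tri h2 (q2P x)].
apply: countable_bigcupT_measurable; first exact: countableP.
move=> i; have [WU|WU] := pselect (W i `<=` U).
  have -> : F i = W i by apply/seteqP; split => [a []|a].
  exact: rational_nbhd_generated.
have -> : F i = set0 by apply/seteqP; split => // a [].
exact: measurable0.
Qed.

Definition trig s (a : Ghat) : R[i] := \sum_(k <- s) k.1 * ev k.2 a.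

Lemma trig1 c x a : trig [:: (c, x)] a = c * ev x a.
Proof. by rewrite /trig big_seq1. Qed.

Lemma trig_cat s t a : trig (s ++ t) a = trig s a + trig t a.
Proof. by rewrite /trig big_cat. Qed.

Lemma trigM s t a : trig [seq (k.1 * l.1, k.2 + l.2) | k <- s, l <- t] a =
  trig s a * trig t a.
Proof.
rewrite /trig big_allpairs_dep mulr_suml; apply: eq_bigr => k _.
by rewrite mulr_sumr; apply: eq_bigr => l _ /=; rewrite evD mulrACA.
Qed.

Lemma cmeasurable_trig s : cmeasurable (trig s).
Proof.
apply: cmeasurable_sum => k; apply: cmeasurableM; first exact: cmeasurable_cst.
exact: cmeasurable_ev.
Qed.

Lemma cbounded_trig s : cbounded (trig s).
Proof.
apply: cbounded_sum => k; apply: cboundedM; first exact: cbounded_cst.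
exact: cbounded_ev.
Qed.

Lemma trig_algebra : test_algebra (range trig).
Proof.
split.
- by move=> _ [s _ <-]; exact: cmeasurable_trig.
- by move=> _ [s _ <-]; exact: cbounded_trig.
- move=> c; exists [:: (c, 0)] => //; apply/funext => a.
  by rewrite trig1 ev0 mulr1.
- move=> _ _ [s _ <-] [t _ <-]; exists (s ++ t) => //; apply/funext => a.
  exact: trig_cat.
- move=> _ _ [s _ <-] [t _ <-].
  exists [seq (k.1 * l.1, k.2 + l.2) | k <- s, l <- t] => //; apply/funext => a.
  exact: trigM.
Qed.

(** A half plane is approximable because Re (c a(x)) is itself a trigonometric
    polynomial in a, of modulus at most 1. *)
Lemma trig_dense (mu : {measure set Ghat -> \bar R}) (w : Ghat -> R) :
  (forall x, 0 <= w x) -> mu.-integrable setT (EFin \o w) ->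
  forall f, cmeasurable f -> cbounded f -> approximable mu (range trig) w f.
Proof.
move=> w0 iw; apply: (approximable_bounded trig_algebra w0 iw borel_dual_generated).
move=> _ [c [x [r [c1 ->]]]].
apply: (rapproximable_gt trig_algebra w0 iw).
  move=> a; rewrite -(ler_sqr (x := `|_|)) ?nnegrE // expr1n real_normK ?num_real //.
  by apply: (@le_trans _ _ (sqmod (c * ev x a))); [rewrite sqmodE lerDl sqr_ge0|rewrite sqmodM c1 sqmod_ev mulr1].
split.
- exact: measurable_Re_ev.
- exists (sqmod (c * ev x point) + 1) => a.
  by have [] := @normr_sqmod _ (c * ev x a) (sqmod (c * ev x point)) _;
    rewrite !sqmodM !sqmod_ev.
apply: approximable_test; exists [:: (c / 2, x); (c^* / 2, - x)] => //.
apply/funext => a; rewrite /trig big_cons big_seq1 /= evN.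
have two : 2^-1 = ((2^-1)%:C)%C :> R[i] by rewrite fmorphV rmorph_nat.
rewrite two; apply: complex_eq; rewrite !Re_Im /=; last by ring.
by field.
Qed.

Section Plancherel.
Variables (mu : {measure set (borel G) -> \bar R})
  (muhat : {measure set Ghat -> \bar R}).
Hypothesis haar_mu : is_haar mu.
Hypothesis counting_mu : mu [set (0 : G)] = 1%E.
Hypothesis dual_muhat : dual_measure mu muhat.

Lemma measurable_discrete (E : set (borel G)) : measurable E.
Proof. by apply: sub_sigma_algebra; exact: discreteG. Qed.

Lemma mu_singleton (x : G) : mu [set x] = 1%E.
Proof.
case: haar_mu => _ _ tr; rewrite -counting_mu -[RHS](tr x); last exact: measurable_discrete.
by rewrite image_set1 addr0.
Qed.

Lemma cintegral_finite (xs : seq G) (f : borel G -> R[i]) : uniq xs ->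
  (forall x, x \notin xs -> f x = 0) ->
  cintegrable mu f /\ cintegral mu f = \sum_(x <- xs) f x.
Proof.
move=> uxs f0.
pose F (y : G) (x : borel G) : R[i] := f y * (\1_[set y] x)%:C%C.
have fE : f = (fun x => \sum_(y <- xs) F y x).
  apply/funext => x; case: (boolP (x \in xs)) => xxs.
    rewrite (big_rem x) //= big1_seq => [|y /=].
      by rewrite addr0 /F indicE mem_set // mulr1.
    rewrite mem_rem_uniq // inE => /andP[yx _].
    rewrite /F indicE memNset ?mulr0 // => /= xy.
    by rewrite xy eqxx in yx.
  rewrite f0 // big1_seq // => y /= yxs.
  rewrite /F indicE memNset ?mulr0 // => /= xy.
  by rewrite xy yxs in xxs.
have ii y : mu.-integrable setT (EFin \o (\1_[set y] : borel G -> R)).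
  have my := measurable_discrete [set y].
  apply/(rint_ge0P mu (f := \1_[set y])) => //.
  by rewrite integral_indic // setIT; change (mu [set y] < +oo)%E; rewrite mu_singleton ltry.
have ic y : cintegrable mu (fun x : borel G => (\1_[set y] x)%:C%C).
  by split => //=; exact: integrable0.
have iF y : cintegrable mu (F y) by exact: cintegrableZ.
split; first by rewrite fE; exact: cintegrable_sum.
rewrite [in LHS]fE cintegral_sum //; apply: eq_bigr => y _.
rewrite cintegralZ // [X in _ * X](_ : _ = 1) ?mulr1 //.
apply: complex_eq => /=; last by rewrite Rintegral_cst // mul0r.
rewrite /Rintegral integral_indic //; last exact: measurable_discrete.
by rewrite setIT; change (fine (mu [set y]) = 1); rewrite mu_singleton.
Qed.

(** Orthonormality of characters, read off from Plancherel's identity for a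
    finitely supported function on the group. *)
Lemma trig_parseval (xs : seq G) (c : G -> R[i]) : uniq xs ->
  (\int[muhat]_a (sqmod (\sum_(x <- xs) c x * ev x a))%:E =
    (\sum_(x <- xs) sqmod (c x))%:E)%E.
Proof.
move=> uxs; pose f (x : borel G) : R[i] := if (x : G) \in xs then (c x)^* else 0.
have f0 x : x \notin xs -> f x = 0 by rewrite /f => /negbTE ->.
have [i_f _] := cintegral_finite uxs f0.
have [|i_s Is] := @cintegral_finite xs (fun x => (sqmod (f x))%:C%C) uxs.
  by move=> x xxs; rewrite f0 // sqmod0.
have E : (\int[mu]_x (sqmod (f x))%:E = (\sum_(x <- xs) sqmod (c x))%:E)%E.
  case: (i_s) => i1 _; rewrite rint_intE //; congr EFin.
  have -> : Rintegral mu setT (fun x => sqmod (f x)) =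
    complex.Re (cintegral mu (fun x => (sqmod (f x))%:C%C)) by [].
  rewrite Is -rmorph_sum /=; apply: eq_big_seq => x xxs.
  by rewrite /f xxs sqmodJ.
rewrite -E -dual_muhat //; last by rewrite E ltry.
apply: eq_integral => a _; congr EFin.
have g0 x : x \notin xs -> f x * ((a : dual R G) x)^* = 0.
  by move=> /f0 ->; rewrite mul0r.
have [_ Ig] := cintegral_finite uxs g0.
rewrite /fourier Ig -[in LHS]sqmodJ rmorph_sum; congr sqmod.
by apply: eq_big_seq => x xxs; rewrite /f xxs rmorphM.
Qed.

Lemma muhat_total : muhat setT = 1%E.
Proof.
have := @trig_parseval [:: 0] (fun=> 1) isT.
under eq_integral do rewrite big_seq1 mul1r ev0 sqmod1.
by rewrite big_seq1 sqmod1 integral_cst // mul1e.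
Qed.

End Plancherel.

End TrigonometricPolynomials.

(** * Orbit combinations and their brackets *)

Section HermitianForm.
Variables (R : realType) (H : completeNormedModType R[i]).
Variable ip : {dot H for @Num.conj R[i]}.
Hypothesis ip_norm : forall v : H, `|v| ^+ 2 = ip v v.
Implicit Types (u v : H) (c : R[i]).

Definition nsq v : R := complex.Re `|v| ^+ 2.

Lemma nsqE v : ip v v = ((nsq v)%:C)%C.
Proof.
rewrite -ip_norm /nsq; have := normr_ge0 v; rewrite lecE /= => /andP[/eqP im0 _].
have e : `|v| = ((complex.Re `|v|)%:C)%C by apply: complex_eq => //=; rewrite im0.
by rewrite {1}e rmorphXn.
Qed.

Lemma nsq_ge0 v : 0 <= nsq v.
Proof. exact: sqr_ge0. Qed.

Lemma ipDl u v z : ip (u + v) z = ip u z + ip v z.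
Proof. exact: linearDl. Qed.

Lemma ipDr u v z : ip z (u + v) = ip z u + ip z v.
Proof. exact: linearDr. Qed.

Lemma ipZl c u v : ip (c *: u) v = c * ip u v.
Proof. exact: linearZl_LR. Qed.

Lemma ipZr c u v : ip v (c *: u) = c^* * ip v u.
Proof. exact: linearZr_LR. Qed.

Lemma ipJ u v : ip u v = (ip v u)^*.
Proof. by rewrite hermC expr0 mul1r. Qed.

Lemma ip0l v : ip 0 v = 0.
Proof. exact: linear0l. Qed.

Lemma ip0r v : ip v 0 = 0.
Proof. exact: linear0r. Qed.

Lemma ip_sumr I (s : seq I) (F : I -> H) v :
  ip v (\sum_(i <- s) F i) = \sum_(i <- s) ip v (F i).
Proof.
by elim: s => [|i s IH]; rewrite ?big_nil ?ip0r // !big_cons ipDr IH.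
Qed.

Lemma nsqB u v : nsq (u - v) = nsq u - 2 * complex.Re (ip u v) + nsq v.
Proof.
apply: (@complexI R); rewrite -[LHS]nsqE.
have eN z y : ip z (- y) = - ip z y by rewrite -scaleN1r ipZr rmorphN rmorph1 mulN1r.
have eN' z y : ip (- y) z = - ip y z by rewrite -scaleN1r ipZl mulN1r.
rewrite ipDl !ipDr !eN !eN' opprK (ipJ v u) !nsqE.
by apply: complex_eq; rewrite /= !Re_Im /=; ring.
Qed.

Lemma sqnormE v : sqnorm v = (nsq v)%:E.
Proof. by []. Qed.

End HermitianForm.

Section Representation.
Variables (R : realType) (G : topologicalZmodType).
Hypothesis second_countableG : @second_countable G.
Hypothesis discreteG : forall U : set G, open U.
Variable (muhat : {measure set (borel (dual R G)) -> \bar R}).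
Variable (H : completeNormedModType R[i]).
Variable ip : {dot H for @Num.conj R[i]}.
Hypothesis ip_norm : forall v : H, `|v| ^+ 2 = ip v v.
Variable pi : G -> {linear H -> H}.
Hypothesis rep_pi : unitary_rep ip pi.
Local Notation Ghat := (borel (dual R G)).
Local Notation rint f := (muhat.-integrable setT (EFin \o f)).
Local Notation is_bracket := (is_bracket ip pi muhat).
Implicit Types (u v th : H) (b t : Ghat -> R[i]) (s : seq (R[i] * G)).

Definition orbit_comb th s : H := \sum_(k <- s) k.1 *: pi k.2 th.

Lemma cintegrable_coef b x : cintegrable muhat b ->
  cintegrable muhat (fun a => b a * ((a : dual R G) x)^*).
Proof.
move=> ib; have m := cmeasurableJ (@cmeasurable_ev R G x).
have c := cboundedJ (@cbounded_ev R G x).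
exact: (cintegrableM ib m c).
Qed.

Lemma is_bracketD u v th b t : is_bracket u th b -> is_bracket v th t ->
  is_bracket (u + v) th (fun a => b a + t a).
Proof.
move=> [ib eb] [it et]; split; first exact: cintegrableD.
move=> x; rewrite ipDl eb et -cintegralD.
- by congr cintegral; apply/funext => a; rewrite mulrDl.
- exact: cintegrable_coef.
- exact: cintegrable_coef.
Qed.

Lemma is_bracketZ c v th b : is_bracket v th b ->
  is_bracket (c *: v) th (fun a => c * b a).
Proof.
move=> [ib eb]; split; first exact: cintegrableZ.
move=> x; rewrite ipZl eb -cintegralZ.
  by congr cintegral; apply/funext => a; rewrite mulrA.
exact: cintegrable_coef.
Qed.

Lemma is_bracket0 th : is_bracket 0 th (fun=> 0).
Proof.
split; first exact: cintegrable0.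
move=> x; rewrite ip0l.
by under [X in cintegral _ X]eq_fun do rewrite mul0r; rewrite cintegral0.
Qed.

Lemma is_bracket_sum I (s : seq I) (F : I -> H) (b : I -> Ghat -> R[i]) th :
  (forall i, is_bracket (F i) th (b i)) ->
  is_bracket (\sum_(i <- s) F i) th (fun a => \sum_(i <- s) b i a).
Proof.
move=> hF; elim: s => [|i s IH].
  rewrite big_nil; under [X in is_bracket _ _ X]eq_fun do rewrite big_nil.
  exact: is_bracket0.
rewrite big_cons; under [X in is_bracket _ _ X]eq_fun do rewrite big_cons.
exact: is_bracketD.
Qed.

(** Translation acts on brackets as modulation by a character. *)
Lemma is_bracket_pi x v th b : is_bracket v th b ->
  is_bracket (pi x v) th (fun a => ev x a * b a).
Proof.
move=> [ib eb]; split.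
  under [X in cintegrable _ X]eq_fun do rewrite mulrC.
  exact: (cintegrableM ib (@cmeasurable_ev R G x) (@cbounded_ev R G x)).
move=> y; rewrite -[y](addrNK x) [y - x + x]addrC (rep_morph rep_pi) (rep_isometry rep_pi) eb.
congr cintegral; apply/funext => a.
change (b a * (ev (y - x) a)^* = ev x a * b a * (ev (x + (y - x)) a)^*).
have e : ev x a * (ev x a)^* = 1 by rewrite mulJ sqmod_ev.
by rewrite (evD x) rmorphM /= mulrACA e mul1r.
Qed.

Lemma is_bracket_comb s v th b : is_bracket v th b ->
  is_bracket (orbit_comb v s) th (fun a => trig s a * b a).
Proof.
move=> hb; have := is_bracket_sum s (fun k : R[i] * G => is_bracketZ k.1 (is_bracket_pi k.2 hb)).
rewrite /orbit_comb; congr is_bracket; apply/funext => a.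
by rewrite /trig mulr_suml; apply: eq_bigr => k _; rewrite mulrA.
Qed.

Lemma ip_comb s v th b : is_bracket v th b ->
  ip v (orbit_comb th s) = cintegral muhat (fun a => b a * (trig s a)^*).
Proof.
move=> [ib eb]; rewrite /orbit_comb ip_sumr.
have ii x : cintegrable muhat (fun a => b a * (ev x a)^*).
  exact: cintegrable_coef.
transitivity (cintegral muhat (fun a =>
    \sum_(k <- s) k.1^* * (b a * (ev k.2 a)^*))).
  rewrite cintegral_sum; last by move=> k; exact: cintegrableZ.
  by apply: eq_bigr => k _; rewrite ipZr eb cintegralZ.
congr cintegral; apply/funext => a; rewrite /trig rmorph_sum mulr_sumr.
by apply: eq_bigr => k _; rewrite rmorphM mulrCA.
Qed.

Lemma ip_comb_comb s th t : is_bracket th th t ->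
  ip (orbit_comb th s) (orbit_comb th s) =
  Complex (Rintegral muhat setT (fun a => sqmod (trig s a) * complex.Re (t a)))
          (Rintegral muhat setT (fun a => sqmod (trig s a) * complex.Im (t a))).
Proof.
move=> ht; rewrite (ip_comb s (is_bracket_comb s ht)) /cintegral.
have e a : trig s a * t a * (trig s a)^* = (sqmod (trig s a))%:C%C * t a.
  by rewrite mulrAC mulJ.
by congr Complex; apply: eq_Rintegral => a _; rewrite e !Re_Im /=; ring.
Qed.

Lemma nsq_comb s th t : is_bracket th th t -> nsq (orbit_comb th s) =
  Rintegral muhat setT (fun a => sqmod (trig s a) * complex.Re (t a)).
Proof. by move=> /(ip_comb_comb s); rewrite nsqE // => -[]. Qed.

Let dense_trig := trig_dense second_countableG discreteG (mu := muhat).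
Let alg_trig := @trig_algebra R G.

(** The bracket of a vector with itself is a positive function, because the
    squared norms of all orbit combinations are nonnegative. *)
Lemma bracket_ge0 th t : is_bracket th th t ->
  {ae muhat, forall a, t a = ((complex.Re (t a))%:C)%C /\ 0 <= complex.Re (t a)}.
Proof.
move=> ht; have [[i1 i2] _] := ht.
have h1 : {ae muhat, forall a, 0 <= complex.Re (t a)}.
  apply: (ae_ge0_of_tests alg_trig dense_trig i1) => _ [s _ <-].
  by rewrite -(nsq_comb s ht) nsq_ge0.
have im0 s : Rintegral muhat setT (fun a => sqmod (trig s a) * complex.Im (t a)) = 0.
  by have := ip_comb_comb s ht; rewrite nsqE // => -[].
have h2 : {ae muhat, forall a, 0 <= complex.Im (t a)}.
  by apply: (ae_ge0_of_tests alg_trig dense_trig i2) => _ [s _ <-]; rewrite im0.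
have h3 : {ae muhat, forall a, 0 <= - complex.Im (t a)}.
  have i2' : rint (fun a => - complex.Im (t a)).
    by under [X in EFin \o X]eq_fun do rewrite -mulN1r; exact: rintZ.
  apply: (ae_ge0_of_tests alg_trig dense_trig i2') => _ [s _ <-].
  have -> : Rintegral muhat setT (fun a => sqmod (trig s a) * - complex.Im (t a)) =
      - Rintegral muhat setT (fun a => sqmod (trig s a) * complex.Im (t a)).
    rewrite -mulN1r -RintegralZl //; first by apply: eq_Rintegral => a _; ring.
    have [C sC] := @cbounded_trig R G s.
    under [X in EFin \o X]eq_fun do rewrite mulrC.
    apply: (rintM (C := C) i2 (measurable_sqmod (@cmeasurable_trig R G s))) => a.
    by rewrite ger0_norm // sqmod_ge0.
  by rewrite im0 oppr0.
apply: filterS3 h1 h2 h3 => a ? ? ?; split => //; apply: complex_eq => //=; lra.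
Qed.

Lemma quad_comb s v th b t : is_bracket v th b -> is_bracket th th t ->
  quad muhat b (fun a => complex.Re (t a)) (trig s) =
  2 * complex.Re (ip v (orbit_comb th s)) - nsq (orbit_comb th s).
Proof.
move=> hb ht; have [ib _] := hb; have [[i1 _] _] := ht.
rewrite (ip_comb s hb) (nsq_comb s ht) /quad /quad_density.
have mp := @cmeasurable_trig R G s; have bp := @cbounded_trig R G s.
have [ir _] := cintegrableM ib (cmeasurableJ mp) (cboundedJ bp).
rewrite RintegralB //; first by rewrite RintegralZl.
  exact: rintZ.
have [C sC] := bp; under [X in EFin \o X]eq_fun do rewrite mulrC.
apply: (rintM (C := C) i1 (measurable_sqmod mp)) => a.
by rewrite ger0_norm // sqmod_ge0.
Qed.

End Representation.

(** * Countable sums and squared norms *)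

Section CountableSums.
Context d (T : measurableType d) (R : realType) (I : choiceType).
Variable mu : {measure set T -> \bar R}.

(** Enumerating a countable index set turns an unordered sum into a series, for
    which termwise integration is available. *)
Lemma esum_countable_integral (A : set I) (q : I -> T -> R) :
  countable A -> (forall i, measurable_fun setT (q i)) ->
  (forall i x, 0 <= q i x) ->
  measurable_fun setT (fun x => \esum_(i in A) (q i x)%:E) /\
  (\int[mu]_x (\esum_(i in A) (q i x)%:E) =
   \esum_(i in A) (\int[mu]_x (q i x)%:E))%E.
Proof.
move=> /countable_injP[f finj] mq q0.
pose S n x : R := if pselect (exists i, A i /\ f i = n) is left e
  then q (projT1 (cid e)) x else 0.
have SE i x : A i -> S (f i) x = q i x.
  move=> Ai; rewrite /S; case: pselect => [e|]; last by case; exists i.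
  by case: cid => j /= [Aj fij]; rewrite (finj j i) ?inE.
have S0 n x : 0 <= S n x by rewrite /S; case: pselect.
have mS n : measurable_fun setT (S n).
  by rewrite /S; case: pselect => // _; exact: measurable_cst.
have bij : set_bij A (f @` A) f.
  split; [by move=> i Ai; exists i|exact: finj|by move=> n].
have esum_series (F : I -> \bar R) (F' : nat -> \bar R) : (forall n, 0 <= F' n)%E ->
    (forall i, A i -> F' (f i) = F i) ->
    (forall n, ~ (f @` A) n -> F' n = 0%E) ->
    \esum_(i in A) F i = (\sum_(0 <= n <oo) F' n)%E.
  move=> F'0 F'E F'N.
  rewrite (nneseries_esum (P := xpredT)) //.
  rewrite (_ : [set x | xpredT x] = [set: nat]); last by apply/seteqP.
  transitivity (\esum_(n in f @` A) F' n).
    by rewrite (reindex_esum A (f @` A) f F' bij); apply: eq_esum => i Ai; rewrite F'E.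
  rewrite esum_mkcond; apply: eq_esum => n _.
  by case: (boolP (n \in f @` A)) => //; rewrite notin_setE => /F'N.
have SN n x : ~ (f @` A) n -> S n x = 0.
  by move=> nA; rewrite /S; case: pselect => // -[i [Ai fi]]; case: nA; exists i.
have E x : \esum_(i in A) (q i x)%:E = (\sum_(0 <= n <oo) (S n x)%:E)%E.
  apply: esum_series => [n|i Ai|n nA]; first by rewrite lee_fin.
    by rewrite SE.
  by rewrite SN.
have EI : \esum_(i in A) (\int[mu]_x (q i x)%:E)%E =
    (\sum_(0 <= n <oo) \int[mu]_x (S n x)%:E)%E.
  apply: esum_series => [n|i Ai|n nA].
  - by apply: integral_ge0 => x _; rewrite lee_fin.
  - by apply: eq_integral => x _; rewrite SE.
  - by apply: integral0_eq => x _; rewrite SN.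
rewrite EI; under eq_fun do rewrite E; split.
  apply: ge0_emeasurable_sum => [n x _ _|n _]; first by rewrite lee_fin.
  exact/measurable_EFinP.
apply: integral_nneseries => // [n|n x _]; last by rewrite lee_fin.
exact/measurable_EFinP.
Qed.

End CountableSums.

Lemma big_group (V : nmodType) (K I : eqType) (s : seq K) (key : K -> I)
    (f : K -> V) :
  \sum_(k <- s) f k = \sum_(i <- undup (map key s)) \sum_(k <- s | key k == i) f k.
Proof.
under [RHS]eq_bigr => i _ do rewrite big_mkcond.
rewrite exchange_big; apply: eq_big_seq => k ks /=.
rewrite (bigD1_seq (key k)) ?undup_uniq ?mem_undup ?map_f //= eqxx.
by rewrite big1 ?addr0 // => i /negbTE; rewrite eq_sym => ->.
Qed.

Section NormSquare.
Variables (R : realType) (H : completeNormedModType R[i]).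
Variable ip : {dot H for @Num.conj R[i]}.
Hypothesis ip_norm : forall v : H, `|v| ^+ 2 = ip v v.
Implicit Types (u v : H).

Lemma nsqN v : nsq (- v) = nsq v.
Proof. by rewrite /nsq normrN. Qed.

Lemma nsq0 : nsq (0 : H) = 0.
Proof. by rewrite /nsq normr0 /= expr0n. Qed.

Lemma nsqD u v : nsq (u + v) = nsq u + 2 * complex.Re (ip u v) + nsq v.
Proof.
have -> : u + v = u - (- v) by rewrite opprK.
rewrite (nsqB ip_norm) nsqN -(scaleN1r v) ipZr rmorphN rmorph1 mulN1r ReN.
by ring.
Qed.

Lemma nsqZ c v : nsq (c *: v) = sqmod c * nsq v.
Proof.
apply: (@complexI R); rewrite -(nsqE ip_norm) ipZl ipZr (nsqE ip_norm).
by rewrite (mulrA c) mulJ -rmorphM.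
Qed.

Lemma nsqD_le u v : nsq (u + v) <= 2 * nsq u + 2 * nsq v.
Proof. by have := nsq_ge0 (u - v); rewrite (nsqB ip_norm) nsqD; lra. Qed.

Lemma nsq_eq0 v : nsq v = 0 -> v = 0.
Proof.
move=> v0; apply/eqP; rewrite -normr_eq0 -sqrf_eq0 ip_norm (nsqE ip_norm) v0.
by rewrite eqxx.
Qed.

Lemma closure_nsq (A : set H) v (e : R) : 0 < e -> closure A v ->
  exists a, A a /\ nsq (v - a) < e.
Proof.
move=> e0 Av.
have [a [Aa va]] : A `&` ball v ((Num.sqrt e)%:C)%C !=set0.
  by apply: Av; apply: nbhsx_ballx; rewrite /= ltcR sqrtr_gt0.
exists a; split=> //; move: va; rewrite -ball_normE /= ltcE /= => /andP[_ va].
rewrite /nsq -[e]sqr_sqrtr ?(ltW e0) // ltr_pXn2r ?nnegrE ?sqrtr_ge0 //.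
by have := normr_ge0 (v - a); rewrite lecE => /andP[].
Qed.

Lemma orthogonal_sum_nsq (I : eqType) (F : seq I) (w : I -> H) : uniq F ->
  (forall i j, i != j -> ip (w i) (w j) = 0) ->
  nsq (\sum_(i <- F) w i) = \sum_(i <- F) nsq (w i).
Proof.
move=> + orth; elim: F => [|i F IH]; first by rewrite !big_nil nsq0.
rewrite /= => /andP[iF uF]; rewrite !big_cons nsqD IH // ip_sumr.
rewrite big1_seq ?mulr0 ?addr0 // => j /= jF; apply: orth.
by apply: contraNneq iF => ->.
Qed.

End NormSquare.

(** * Parseval's identity for orthogonal generators *)

Section Parseval.
Variables (R : realType) (G : topologicalZmodType).
Hypothesis second_countableG : @second_countable G.
Hypothesis discreteG : forall U : set G, open U.
Variable (muhat : {measure set (borel (dual R G)) -> \bar R}).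
Variable (H : completeNormedModType R[i]).
Variable ip : {dot H for @Num.conj R[i]}.
Hypothesis ip_norm : forall v : H, `|v| ^+ 2 = ip v v.
Variable pi : G -> {linear H -> H}.
Hypothesis rep_pi : unitary_rep ip pi.
Hypothesis dual_pi : dual_integrable ip pi muhat.
Variables (I : choiceType) (theta : I -> H).
Hypothesis gen_theta : orthogonal_generators ip pi theta.
Local Notation Ghat := (borel (dual R G)).
Local Notation rint f := (muhat.-integrable setT (EFin \o f)).
Local Notation is_bracket := (is_bracket ip pi muhat).
Local Notation orbit_comb := (orbit_comb pi).

Let dense_trig := trig_dense second_countableG discreteG (mu := muhat).
Let alg_trig := @trig_algebra R G.

Lemma bracketP (u v : H) : is_bracket u v (bracket ip pi muhat u v).
Proof. exact: xgetPex (dual_pi u v). Qed.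

Definition gram (i : I) (a : Ghat) : R[i] := bracket ip pi muhat (theta i) (theta i) a.

(** A representative of [theta_i, theta_i] is real only almost everywhere, so its
    real part is taken. *)
Definition regram (i : I) (a : Ghat) : R := complex.Re (gram i a).

Lemma gramP i : is_bracket (theta i) (theta i) (gram i).
Proof. exact: bracketP. Qed.

Lemma rint_regram i : rint (regram i).
Proof. by have [[]] := gramP i. Qed.

Lemma gram_real i :
  {ae muhat, forall a, gram i a = ((regram i a)%:C)%C /\ 0 <= regram i a}.
Proof. exact: (bracket_ge0 second_countableG discreteG ip_norm rep_pi (gramP i)). Qed.

Lemma regram_ge0 i : {ae muhat, forall a, 0 <= regram i a}.
Proof. by apply: filterS (gram_real i) => a []. Qed.

Lemma orbit_comb_lspan (v : H) s : lspan (range (fun x => pi x v)) (orbit_comb v s).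
Proof.
exists (size s), (fun k => (nth (0, 0) s k).1), (fun k => pi (nth (0, 0) s k).2 v).
split; first by move=> k; exists (nth (0, 0) s k).2.
by rewrite /orbit_comb (big_nth (0, 0)) big_mkord.
Qed.

Lemma orbit_comb_orth i j s s' : i != j ->
  ip (orbit_comb (theta i) s) (orbit_comb (theta j) s') = 0.
Proof.
case: gen_theta => orth _ ij; apply: (orth i j ij).
  exact/subset_closure/orbit_comb_lspan.
exact/subset_closure/orbit_comb_lspan.
Qed.

Definition generated (s : seq (I * (R[i] * G))) : H :=
  \sum_(k <- s) k.2.1 *: pi k.2.2 (theta k.1).

(** The vectors that can be approximated in this way form a closed subspace, and
    it contains the orbits of all generators. *)
Lemma generated_dense (v : H) (e : R) : 0 < e -> exists s, nsq (v - generated s) < e.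
Proof.
pose M : set H := [set v | forall e : R, 0 < e -> exists s, nsq (v - generated s) < e].
suff : M v by move=> Mv e0; exact: Mv.
have clM (A : set H) : A `<=` M -> closure A `<=` M.
  move=> AM u clu d d0; have d4 : 0 < (d / 2) / 2 by rewrite !divr_gt0.
  have [a [Aa ua]] := closure_nsq d4 clu.
  have [s as_] := AM _ Aa _ d4; exists s.
  have -> : u - generated s = (u - a) + (a - generated s) by rewrite addrA subrK.
  by apply: (le_lt_trans (nsqD_le ip_norm _ _)); lra.
have M0 : M 0 by move=> d d0; exists [::]; rewrite /generated big_nil subrr nsq0.
have MD u w : M u -> M w -> M (u + w).
  move=> Mu Mw d d0; have d4 : 0 < (d / 2) / 2 by rewrite !divr_gt0.
  have [s us] := Mu _ d4; have [s' ws] := Mw _ d4; exists (s ++ s').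
  have -> : u + w - generated (s ++ s') = (u - generated s) + (w - generated s').
    by rewrite /generated big_cat opprD addrACA.
  by apply: (le_lt_trans (nsqD_le ip_norm _ _)); lra.
have MZ c u : M u -> M (c *: u).
  move=> Mu d d0.
  have k0 : 0 < sqmod c + 1 by rewrite ltr_wpDl ?sqmod_ge0.
  have dk : 0 < d / (sqmod c + 1) by rewrite divr_gt0.
  have [s us] := Mu _ dk; exists [seq (k.1, (c * k.2.1, k.2.2)) | k <- s].
  have -> : c *: u - generated [seq (k.1, (c * k.2.1, k.2.2)) | k <- s] =
      c *: (u - generated s).
    rewrite scalerBr /generated big_map scaler_sumr; congr (_ - _).
    by apply: eq_bigr => k _; rewrite /= scalerA.
  rewrite (nsqZ ip_norm); move: us; rewrite ltr_pdivlMr //.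
  by have := nsq_ge0 (u - generated s); have := sqmod_ge0 c; nra.
have lsM (A : set H) : A `<=` M -> lspan A `<=` M.
  move=> AM _ [n [c [x [Ax ->]]]]; elim/big_ind: _ => // k _.
  by apply: MZ; apply: AM; exact: Ax.
have : cspan (\bigcup_i cyclic_space pi (theta i)) v by case: gen_theta => _ ->.
apply: (clM); apply: (lsM) => u [i _]; apply: (clM); apply: (lsM) => _ [x _ <-] d d0.
by exists [:: (i, (1, x))]; rewrite /generated big_seq1 scale1r subrr nsq0.
Qed.

Lemma generatedE s : generated s = \sum_(i <- undup (map fst s))
  orbit_comb (theta i) [seq k.2 | k <- s & k.1 == i].
Proof.
rewrite /generated (big_group s fst); apply: eq_bigr => i _.
rewrite /orbit_comb big_map big_filter; apply: eq_bigr => k /eqP -> //.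
Qed.

Section Vector.
Variables (v : H) (b : I -> Ghat -> R[i]).
Hypothesis hb : forall i, is_bracket v (theta i) (b i).

(** Almost everywhere the squared modulus of the i-th coordinate of the fiber of
    v, by the convention 0^-1 = 0; the maximum with 0 makes it nonnegative
    everywhere. *)
Definition component_density i (a : Ghat) : R :=
  Num.max 0 (quotient_density (b i) (regram i) a).

Local Notation Q i := (\int[muhat]_a (component_density i a)%:E)%E.

Let ib i : cintegrable muhat (b i) := (hb i).1.

(** Bessel's inequality in the form where the approximating combination is
    free: the square of the distance from [v] to it is nonnegative. *)
Lemma bessel_quad (F : seq I) (p : I -> seq (R[i] * G)) : uniq F ->
  \sum_(i <- F) quad muhat (b i) (regram i) (trig (p i)) <= nsq v.
Proof.
move=> uF; pose w := \sum_(i <- F) orbit_comb (theta i) (p i).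
have -> : \sum_(i <- F) quad muhat (b i) (regram i) (trig (p i)) =
    2 * complex.Re (ip v w) - nsq w.
  rewrite /w (orthogonal_sum_nsq ip_norm uF); last first.
    by move=> i j ij; exact: orbit_comb_orth.
  rewrite ip_sumr (raddf_sum (@complex.Re R : Rcomplex R -> R)) mulr_sumr -sumrB.
  apply: eq_bigr => i _.
  exact: (quad_comb ip_norm rep_pi (p i) (hb i) (gramP i)).
by have := nsq_ge0 (v - w); rewrite (nsqB ip_norm); lra.
Qed.

Lemma component_bound i : (Q i <= (nsq v)%:E)%E.
Proof.
rewrite leNgt; apply/negP.
move=> /(quad_sup alg_trig dense_trig (ib i) (rint_regram i))[_ [[s _ <-]]].
by have := @bessel_quad [:: i] (fun=> s) isT; rewrite big_seq1 => /le_lt_trans h /h; rewrite ltxx.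
Qed.

Lemma Q_ge0 i : (0 <= Q i)%E.
Proof. by apply: integral_ge0 => a _; rewrite lee_fin le_max lexx. Qed.

Lemma QE i : Q i = (fine (Q i))%:E.
Proof.
rewrite fineK // ge0_fin_numE ?Q_ge0 //.
by apply: (le_lt_trans (component_bound i)); rewrite ltry.
Qed.

Lemma bessel_components (F : seq I) : uniq F -> \sum_(i <- F) fine (Q i) <= nsq v.
Proof.
move=> uF; apply/ler_addgt0Pr => e e0.
pose d := e / ((size F).+1)%:R.
have d0 : 0 < d by rewrite divr_gt0 // ltr0n.
have near_sup i : exists s, fine (Q i) - d < quad muhat (b i) (regram i) (trig s).
  have lt : ((fine (Q i) - d)%:E < Q i)%E by rewrite [ltRHS]QE lte_fin ltrBlDr ltrDl.
  have [_ [[s _ <-] ?]] := quad_sup alg_trig dense_trig (ib i) (rint_regram i) lt.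
  by exists s.
have [p pP] := choice near_sup.
apply: (@le_trans _ _ (\sum_(i <- F) (quad muhat (b i) (regram i) (trig (p i)) + d))).
  by apply: ler_sum => i _; have := pP i; lra.
rewrite big_split /=; apply: lerD; first exact: bessel_quad.
rewrite big_const_seq count_predT iter_addr_0 -mulr_natr /d -mulrA ger_pMr //.
by rewrite ler_pdivrMl ?ltr0n // mulr1 ler_nat.
Qed.

Lemma component_vanish i : {ae muhat, forall a, regram i a <= 0 -> b i a = 0}.
Proof.
apply: (ae_eq0_of_quad_le alg_trig dense_trig (ib i) (rint_regram i)
  (K := nsq v)) => _ [s _ <-].
by have := @bessel_quad [:: i] (fun=> s) isT; rewrite big_seq1.
Qed.

(** One inequality is Bessel's, with the supremum over trigonometric multipliers
    computed in each component; for the other, approximate v by a combination w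
    of orbits and bound 2 Re <v, w> - |w|^2 componentwise. *)
Lemma parseval : (nsq v)%:E = \esum_(i in [set: I]) Q i.
Proof.
apply/eqP; rewrite eq_le; apply/andP; split; last first.
  apply: ub_ereal_sup => _ [F [finF _] <-].
  rewrite fsbig_finite //=.
  under eq_bigr do rewrite QE.
  by rewrite sumEFin lee_fin; apply: bessel_components; exact: fset_uniq.
apply/lee_addgt0Pr => e e0.
have [s vs] := generated_dense v e0.
set w := generated s in vs.
pose F := undup (map fst s); have uF : uniq F by exact: undup_uniq.
pose p i := [seq k.2 | k <- s & k.1 == i].
have lt : nsq v < e + \sum_(i <- F) quad muhat (b i) (regram i) (trig (p i)).
  have -> : \sum_(i <- F) quad muhat (b i) (regram i) (trig (p i)) =
      2 * complex.Re (ip v w) - nsq w.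
    rewrite /w generatedE (orthogonal_sum_nsq ip_norm uF); last first.
      by move=> i j ij; exact: orbit_comb_orth.
    rewrite ip_sumr (raddf_sum (@complex.Re R : Rcomplex R -> R)) mulr_sumr -sumrB.
    apply: eq_bigr => i _.
    exact: (quad_comb ip_norm rep_pi (p i) (hb i) (gramP i)).
  by move: vs; rewrite (nsqB ip_norm); lra.
apply: (@le_trans _ _ (e + \sum_(i <- F) quad muhat (b i) (regram i) (trig (p i)))%:E).
  by rewrite lee_fin ltW.
rewrite EFinD addeC leeD2r //.
apply: (@le_trans _ _ (\sum_(i <- F) Q i)%E).
  rewrite -sumEFin; apply: lee_sum => i _.
  apply: (quad_le_quotient (ib i) (rint_regram i) (regram_ge0 i) (component_vanish i)).
    exact: cmeasurable_trig.
  exact: cbounded_trig.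
apply: ereal_sup_ubound; exists [set` F]; last by rewrite -fsbig_seq.
by split => //; exact: finite_seq.
Qed.

End Vector.

End Parseval.

(** * Riesz sequences and rational coefficients *)

Section SquareSummable.
Variables (R : realType) (I : choiceType).
Implicit Types (x y : I -> R[i]).

Lemma esumZl (k : R) (a : I -> \bar R) : 0 <= k -> (forall i, 0 <= a i)%E ->
  \esum_(i in [set: I]) (k%:E * a i)%E = (k%:E * \esum_(i in [set: I]) a i)%E.
Proof.
have le (k' : R) (a' : I -> \bar R) : 0 <= k' -> (forall i, 0 <= a' i)%E ->
    (\esum_(i in [set: I]) (k'%:E * a' i) <= k'%:E * \esum_(i in [set: I]) a' i)%E.
  move=> k0 a0; apply: ub_ereal_sup => _ [F [finF _] <-].
  rewrite fsbig_finite //= -ge0_sume_distrr //; apply: lee_wpmul2l; first by rewrite lee_fin.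
  by apply: ereal_sup_ubound; exists F => //; rewrite fsbig_finite.
move=> k0 a0; apply/eqP; rewrite eq_le le //=.
have [->|kn0] := eqVneq k 0.
  by rewrite mul0e esum_ge0 // => i _; rewrite mul0e.
have kp : 0 < k by rewrite lt_def kn0.
have b0 i : (0 <= k%:E * a i)%E by rewrite mule_ge0 // lee_fin.
have kV : 0 <= k^-1 by rewrite invr_ge0.
have := le k^-1 (fun i => k%:E * a i)%E kV b0.
have e i : (k^-1%:E * (k%:E * a i) = a i)%E.
  by rewrite muleA -EFinM mulVf ?mul1e.
under eq_esum do rewrite e; move=> h.
rewrite -(lee_pmul2l (x := k^-1%:E)) //; last by rewrite lte_fin invr_gt0.
by rewrite muleA -EFinM mulVf // mul1e.
Qed.

Lemma l2_sqnorm_ge0 x : (0 <= l2_sqnorm x)%E.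
Proof. by apply: esum_ge0 => i _; rewrite lee_fin sqmod_ge0. Qed.

Lemma l2_sqnormZ (c : R[i]) x : l2_sqnorm (c *: x) = ((sqmod c)%:E * l2_sqnorm x)%E.
Proof.
rewrite /l2_sqnorm -esumZl ?sqmod_ge0 //.
  by apply: eq_esum => i _; rewrite -EFinM -sqmodM.
by move=> i; rewrite lee_fin sqmod_ge0.
Qed.

Definition l2_finite x := (l2_sqnorm x < +oo)%E.

Definition l2_norm2 x : R := fine (l2_sqnorm x).

Lemma l2_finiteE x : l2_finite x -> l2_sqnorm x = (l2_norm2 x)%:E.
Proof. by move=> fx; rewrite /l2_norm2 fineK // ge0_fin_numE // l2_sqnorm_ge0. Qed.

Lemma l2_norm2_ge0 x : 0 <= l2_norm2 x.
Proof. exact/fine_ge0/l2_sqnorm_ge0. Qed.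

Lemma l2_finiteZ c x : l2_finite x -> l2_finite (c *: x).
Proof. by rewrite /l2_finite l2_sqnormZ => /l2_finiteE ->; rewrite -EFinM ltry. Qed.

Lemma l2_norm2Z c x : l2_finite x -> l2_norm2 (c *: x) = sqmod c * l2_norm2 x.
Proof. by rewrite /l2_norm2 l2_sqnormZ => /l2_finiteE ->. Qed.

Lemma l2_finite0 : l2_finite 0.
Proof.
rewrite -[0](scale0r (0 : I -> R[i])) /l2_finite l2_sqnormZ sqmod0.
by rewrite mul0e ltry.
Qed.

Lemma l2_norm20 : l2_norm2 0 = 0.
Proof. by rewrite -[X in l2_norm2 X](scale0r (0 : I -> R[i])) l2_norm2Z ?sqmod0 ?mul0r //; exact: l2_finite0. Qed.

Lemma l2_norm2D (e : R) x y : 0 < e -> l2_finite x -> l2_finite y ->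
  l2_finite (x + y) /\
  l2_norm2 (x + y) <= (1 + e) * l2_norm2 x + (1 + e^-1) * l2_norm2 y.
Proof.
move=> e0 fx fy.
have k1 : 0 <= 1 + e by rewrite addr_ge0 // ltW.
have k2 : 0 <= 1 + e^-1 by rewrite addr_ge0 // invr_ge0 ltW.
have s0 z i : (0 <= (sqmod (z i : R[i]))%:E)%E by rewrite lee_fin sqmod_ge0.
have le : (l2_sqnorm (x + y)%R <=
    ((1 + e) * l2_norm2 x + (1 + e^-1) * l2_norm2 y)%:E)%E.
  rewrite EFinD !EFinM -(l2_finiteE fx) -(l2_finiteE fy) /l2_sqnorm -!esumZl //.
  rewrite -esumD => [|i _|i _]; try by rewrite mule_ge0 // lee_fin.
  apply: le_esum => i _; rewrite -!EFinM -EFinD lee_fin; exact: sqmodD_le.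
have f : l2_finite (x + y) by apply: (le_lt_trans le); rewrite ltry.
by split=> //; rewrite -lee_fin -(l2_finiteE f).
Qed.

(** The crude constant 2 ^ size s is harmless: it is used for a fixed list s and
    coefficients tending to 0. *)
Lemma l2_norm2_sum (J : eqType) (s : seq J) (e : J -> R[i]) (u : J -> I -> R[i]) :
  (forall j, l2_finite (u j)) ->
  l2_finite (\sum_(j <- s) e j *: u j) /\
  l2_norm2 (\sum_(j <- s) e j *: u j) <=
    2 ^+ size s * \sum_(j <- s) sqmod (e j) * l2_norm2 (u j).
Proof.
move=> fu; elim: s => [|j s [f IH]].
  by rewrite !big_nil l2_norm20 mulr0; split => //; exact: l2_finite0.
rewrite !big_cons; have fj := l2_finiteZ (e j) (fu j).
have [fD] := l2_norm2D ltr01 fj f; rewrite invr1 => le; split => //.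
apply: (le_trans le); rewrite l2_norm2Z // exprS.
set p := (2 : R) ^+ size s in IH *.
have p1 : 1 <= p by rewrite exprn_ege1 // ler1n.
have : 0 <= sqmod (e j) * l2_norm2 (u j) by rewrite mulr_ge0 ?sqmod_ge0 ?l2_norm2_ge0.
move: (sqmod (e j) * _) => m m0; nra.
Qed.

End SquareSummable.

Section RieszSequences.
Variable R : realType.

Lemma fsum_seq (V : nmodType) (J : choiceType) (s : seq J) (F : J -> V) :
  uniq s -> (forall j, j \notin s -> F j = 0) ->
  \sum_(j \in [set: J]) F j = \sum_(j <- s) F j.
Proof.
move=> us F0; rewrite (fsbigE s) //; last by move=> j _; exact: F0.
by apply: eq_bigl => j; rewrite in_setT.
Qed.

(** Only finitely many coefficients matter, so the coefficient families may be
    replaced by arbitrary ones on a finite duplicate-free list of indices. *)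
Lemma riesz_sequence_finite (V : lmodType R[i]) (N : V -> \bar R)
    (J : choiceType) (u : J -> V) (A B : R) :
  riesz_sequence N u A B <->
  (forall j, N (u j) < +oo)%E /\
  forall (s : seq J) (c : J -> R[i]), uniq s ->
    ((A * \sum_(j <- s) sqmod (c j))%R%:E <= N (\sum_(j <- s) c j *: u j)%R
       <= (B * \sum_(j <- s) sqmod (c j))%R%:E)%E.
Proof.
split=> -[fin H]; split => //.
  move=> s c us; pose c' j := if j \in s then c j else 0.
  have finc : finite_set [set j | c' j != 0].
    apply: (sub_finite_set _ (finite_seq s)) => j /=; rewrite /c'.
    by case: ifP => //; rewrite eqxx.
  have := H c' finc; rewrite /=.
  have out j : j \notin s -> c' j = 0 by rewrite /c' => /negbTE ->.
  rewrite (fsum_seq us); last by move=> j /out ->; rewrite sqmod0.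
  rewrite (fsum_seq us); last by move=> j /out ->; rewrite scale0r.
  rewrite (eq_big_seq (fun j => sqmod (c j))); last by move=> j js; rewrite /c' js.
  by rewrite (eq_big_seq (fun j => c j *: u j)) // => j js; rewrite /c' js.
move=> c /finite_fsetP[X cX].
have out j : j \notin finmap.enum_fset X -> c j = 0.
  by move=> jX; apply/eqP; apply: contraNT jX => cj; have : [set` X] j by rewrite -cX.
rewrite (fsum_seq (fset_uniq X)); last by move=> j /out ->; rewrite sqmod0.
rewrite (fsum_seq (fset_uniq X)); last by move=> j /out ->; rewrite scale0r.
exact: H (fset_uniq X).
Qed.

End RieszSequences.

Section RationalCoefficients.
Variables (R : realType) (I : choiceType) (J : eqType).
Variables (u : J -> I -> R[i]) (A B : R).
Hypotheses (A_gt0 : 0 < A) (leAB : A <= B).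
Hypothesis fin_u : forall j, l2_finite (u j).

Definition rational_coef (s : seq J) (r : seq (rat * rat)) (j : J) : R[i] :=
  let q := nth (0, 0) r (index j s) in Complex (ratr q.1) (ratr q.2).

Lemma rational_coef_near (s : seq J) (c : J -> R[i]) (e : R) : 0 < e ->
  exists r, forall j, j \in s -> sqmod (c j - rational_coef s r j) <= e ^+ 2.
Proof.
move=> e0; have e2 : 0 < e / 2 by rewrite divr_gt0.
have [q1 q1P] := choice (fun j => rational_near (complex.Re (c j)) e2).
have [q2 q2P] := choice (fun j => rational_near (complex.Im (c j)) e2).
exists [seq (q1 j, q2 j) | j <- s] => j js.
rewrite /rational_coef (nth_map j) ?index_mem // nth_index //= sqmodE !Re_Im /=.
have sq (y : R) : `|y| < e / 2 -> y ^+ 2 <= e ^+ 2 / 4.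
  by move=> ye; rewrite -real_normK ?num_real //; have := normr_ge0 y; nra.
by have := sq _ (q1P j); have := sq _ (q2P j); have := sqr_ge0 e; lra.
Qed.

(** Both sides of the Riesz inequalities are continuous in the coefficients, so
    rational coefficients suffice. *)
Lemma riesz_of_rational (s : seq J) (c : J -> R[i]) :
  (forall r, let d := rational_coef s r in
    A * \sum_(j <- s) sqmod (d j) <= l2_norm2 (\sum_(j <- s) d j *: u j)
      <= B * \sum_(j <- s) sqmod (d j)) ->
  A * \sum_(j <- s) sqmod (c j) <= l2_norm2 (\sum_(j <- s) c j *: u j)
    <= B * \sum_(j <- s) sqmod (c j).
Proof.
move=> H.
set C2 := \sum_(j <- s) sqmod (c j); set Nc := l2_norm2 _.
pose n : R := (size s)%:R.
pose D := 2 ^+ size s * \sum_(j <- s) l2_norm2 (u j).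
have C20 : 0 <= C2 by apply: sumr_ge0 => j _; exact: sqmod_ge0.
have Nc0 : 0 <= Nc by exact: l2_norm2_ge0.
have n0 : 0 <= n by rewrite ler0n.
have D0 : 0 <= D.
  by rewrite mulr_ge0 ?exprn_ge0 //; apply: sumr_ge0 => j _; exact: l2_norm2_ge0.
have B_gt0 : 0 < B by exact: lt_le_trans leAB.
(* With coefficients approximated within e, every error term is O(e). *)
have approx (e : R) : 0 < e <= 1 ->
    A * C2 <= Nc + e * (3 * Nc + 4 * D + 2 * (A * n)) /\
    Nc <= B * C2 + e * (3 * (B * C2) + 4 * (B * n) + 2 * D).
  move=> /andP[e0 e1]; have [r near] := rational_coef_near s c e0.
  set d := rational_coef s r in near.
  have /andP[HA HB] := H r; rewrite -/d in HA HB.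
  set D2 := \sum_(j <- s) sqmod (d j) in HA HB.
  set Nd := l2_norm2 _ in HA HB.
  have D20 : 0 <= D2 by apply: sumr_ge0 => j _; exact: sqmod_ge0.
  have Nd0 : 0 <= Nd by exact: l2_norm2_ge0.
  have k : (1 + e^-1) * e ^+ 2 = e ^+ 2 + e.
    by rewrite mulrDl mul1r; congr (_ + _); rewrite expr2 mulrA mulVf ?mul1r // gt_eqF.
  have k0 : 0 <= 1 + e^-1 by rewrite addr_ge0 // invr_ge0 ltW.
  have sum_le (F G : J -> R[i]) : (forall j, j \in s -> sqmod (G j - F j) <= e ^+ 2) ->
      \sum_(j <- s) sqmod (G j) <= (1 + e) * \sum_(j <- s) sqmod (F j) + (e ^+ 2 + e) * n.
    move=> FG; rewrite mulr_sumr /n -[(size s)%:R]mulr1 mulr_natl.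
    rewrite -(count_predT s) -iter_addr_0 -big_const_seq mulr_sumr -big_split /=.
    rewrite big_seq [leRHS]big_seq; apply: ler_sum => j js.
    have -> : G j = F j + (G j - F j) by rewrite addrC subrK.
    apply: (le_trans (sqmodD_le _ _ e0)); rewrite lerD2l mulr1 -k.
    by rewrite ler_wpM2l //; exact: FG.
  have norm_le (F G : J -> R[i]) : (forall j, j \in s -> sqmod (G j - F j) <= e ^+ 2) ->
      l2_norm2 (\sum_(j <- s) G j *: u j) <=
      (1 + e) * l2_norm2 (\sum_(j <- s) F j *: u j) + (e ^+ 2 + e) * D.
    move=> FG.
    have -> : \sum_(j <- s) G j *: u j =
        \sum_(j <- s) F j *: u j + \sum_(j <- s) (G j - F j) *: u j.
      by rewrite -big_split /=; apply: eq_bigr => j _; rewrite -scalerDl addrC subrK.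
    have [fF _] := l2_norm2_sum s F fin_u.
    have [fG leG] := l2_norm2_sum s (fun j => G j - F j) fin_u.
    have [_ le] := l2_norm2D e0 fF fG; apply: (le_trans le).
    rewrite lerD2l -k -mulrA ler_wpM2l //; apply: (le_trans leG).
    rewrite /D mulrCA ler_wpM2l ?exprn_ge0 // mulr_sumr big_seq [leRHS]big_seq.
    by apply: ler_sum => j js; rewrite ler_wpM2r ?l2_norm2_ge0 //; exact: FG.
  have near' j : j \in s -> sqmod (d j - c j) <= e ^+ 2.
    by move=> /near; rewrite -opprB sqmodN.
  have h1 := sum_le _ _ near; have h2 := sum_le _ _ near'.
  have h3 := norm_le _ _ near; have h4 := norm_le _ _ near'.
  rewrite -/C2 -/D2 in h1 h2; rewrite -/Nc -/Nd in h3 h4.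
  have ee : e ^+ 2 <= e by rewrite expr2 ler_piMl // ltW.
  have e20 : 0 <= e ^+ 2 by exact: sqr_ge0.
  split.
    have AD : A * D2 <= (1 + e) * Nc + (e ^+ 2 + e) * D by exact: le_trans HA h4.
    have : A * C2 <= (1 + e) * (A * D2) + (e ^+ 2 + e) * (A * n).
      have -> : (1 + e) * (A * D2) + (e ^+ 2 + e) * (A * n) =
        A * ((1 + e) * D2 + (e ^+ 2 + e) * n) by ring.
      by rewrite ler_pM2l.
    have : (1 + e) * (A * D2) <= (1 + e) * ((1 + e) * Nc + (e ^+ 2 + e) * D).
      by rewrite ler_wpM2l // addr_ge0 // ltW.
    have An0 : 0 <= A * n by rewrite mulr_ge0 // ltW.
    have i1 : e ^+ 2 * (A * n) <= e * (A * n) by rewrite ler_wpM2r.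
    have i2 : e ^+ 2 * Nc <= e * Nc by rewrite ler_wpM2r.
    have i3 : e ^+ 2 * D <= e * D by rewrite ler_wpM2r.
    have i4 : e * (e ^+ 2 * D) <= e ^+ 2 * D.
      by rewrite ler_piMl // mulr_ge0.
    have -> : (1 + e) * ((1 + e) * Nc + (e ^+ 2 + e) * D) =
      Nc + 2 * (e * Nc) + e ^+ 2 * Nc + e * D + 2 * (e ^+ 2 * D) + e * (e ^+ 2 * D) by ring.
    lra.
  have BD : B * D2 <= (1 + e) * (B * C2) + (e ^+ 2 + e) * (B * n).
    have -> : (1 + e) * (B * C2) + (e ^+ 2 + e) * (B * n) =
      B * ((1 + e) * C2 + (e ^+ 2 + e) * n) by ring.
    by rewrite ler_pM2l.
  have : (1 + e) * Nd <= (1 + e) * ((1 + e) * (B * C2) + (e ^+ 2 + e) * (B * n)).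
    by rewrite ler_wpM2l ?addr_ge0 ?(ltW e0) //; exact: le_trans HB BD.
  have Bn0 : 0 <= B * n by rewrite mulr_ge0 // ltW.
  have BC0 : 0 <= B * C2 by rewrite mulr_ge0 // ltW.
  have i1 : e ^+ 2 * (B * n) <= e * (B * n) by rewrite ler_wpM2r.
  have i2 : e ^+ 2 * (B * C2) <= e * (B * C2) by rewrite ler_wpM2r.
  have i3 : e ^+ 2 * D <= e * D by rewrite ler_wpM2r.
  have i4 : e * (e ^+ 2 * (B * n)) <= e ^+ 2 * (B * n).
    by rewrite ler_piMl // mulr_ge0.
  have -> : (1 + e) * ((1 + e) * (B * C2) + (e ^+ 2 + e) * (B * n)) =
    B * C2 + 2 * (e * (B * C2)) + e ^+ 2 * (B * C2) + e * (B * n) +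
    2 * (e ^+ 2 * (B * n)) + e * (e ^+ 2 * (B * n)) by ring.
  lra.
have limit (X Y K : R) : 0 <= K -> (forall e, 0 < e <= 1 -> X <= Y + e * K) -> X <= Y.
  move=> K0 le; apply/ler_addgt0Pr => e e0.
  pose f := Num.min 1 (e / (K + 1)).
  have K1 : 0 < K + 1 by rewrite ltr_wpDl.
  have f0 : 0 < f <= 1 by rewrite lt_min ltr01 divr_gt0 //= ge_min lexx.
  apply: (le_trans (le f f0)); rewrite lerD2l.
  apply: (@le_trans _ _ (e / (K + 1) * K)).
    by rewrite ler_wpM2r // ge_min lexx orbT.
  by rewrite mulrAC ler_pdivrMr // ler_pM2l //; lra.
apply/andP; split.
  apply: limit (fun e he => (approx e he).1).
  have : 0 <= A * n by rewrite mulr_ge0 // ltW.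
  lra.
apply: limit (fun e he => (approx e he).2).
have : 0 <= B * n by rewrite mulr_ge0 // ltW.
have : 0 <= B * C2 by rewrite mulr_ge0 // ltW.
lra.
Qed.

End RationalCoefficients.

(** * The fiber map *)

Lemma ae_forall_countable d (T : measurableType d) (R : realType)
    (mu : {measure set T -> \bar R}) (I : Type) (A : set I) (P : I -> T -> Prop) :
  countable A -> (forall i, A i -> {ae mu, forall x, P i x}) ->
  {ae mu, forall x i, A i -> P i x}.
Proof.
move=> /countable_injP[f finj] aeP.
have H n : {ae mu, forall x i, A i -> f i = n -> P i x}.
  have [[i [Ai fi]]|no] := pselect (exists i, A i /\ f i = n).
    apply: filterS (aeP i Ai) => x Pix j Aj fj.
    by rewrite (finj j i) ?inE // fj fi.
  by apply: aeW => x i Ai fi; case: no; exists i.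
by have := ae_foralln H; apply: filterS => x Hx i Ai; exact: (Hx (f i)).
Qed.

Section Fibers.
Variables (R : realType) (G : topologicalZmodType).
Hypothesis second_countableG : @second_countable G.
Hypothesis discreteG : forall U : set G, open U.
Variable (muhat : {measure set (borel (dual R G)) -> \bar R}).
Variable (H : completeNormedModType R[i]).
Variable ip : {dot H for @Num.conj R[i]}.
Hypothesis ip_norm : forall v : H, `|v| ^+ 2 = ip v v.
Hypothesis separableH : exists2 D : set H, countable D & dense D.
Variable pi : G -> {linear H -> H}.
Hypothesis rep_pi : unitary_rep ip pi.
Hypothesis dual_pi : dual_integrable ip pi muhat.
Variables (I : choiceType) (theta : I -> H).
Hypothesis gen_theta : orthogonal_generators ip pi theta.
Local Notation Ghat := (borel (dual R G)).
Local Notation rint f := (muhat.-integrable setT (EFin \o f)).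
Local Notation is_bracket := (is_bracket ip pi muhat).
Local Notation gramT := (gram muhat ip pi theta).
Local Notation regramT := (regram muhat ip pi theta).

Definition nonzero_generators : set I := [set i | theta i != 0].

(** Distinct nonzero generators are orthogonal, hence so far apart that they
    need distinct approximants from a countable dense set. *)
Lemma countable_nonzero_generators : countable nonzero_generators.
Proof.
have [D cD dD] := separableH.
have near i : nonzero_generators i -> exists x, D x /\ nsq (theta i - x) < nsq (theta i) / 4.
  move=> i0; have pos : 0 < nsq (theta i) / 4.
    rewrite divr_gt0 // lt_def nsq_ge0 andbT.
    by apply: contra_neq i0; exact: (nsq_eq0 ip_norm).
  apply: (closure_nsq pos) => B nB.
  have [x [Bx Dx]] := dD B^° (ex_intro _ (theta i) nB) (@open_interior _ B).
  by exists x; split => //; exact: interior_subset.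
pose g i := xget 0 [set x | D x /\ nsq (theta i - x) < nsq (theta i) / 4].
have gP i : nonzero_generators i -> D (g i) /\ nsq (theta i - g i) < nsq (theta i) / 4.
  by move=> /near e; exact: (xgetPex (0 : H) e).
have orth i j : i != j -> ip (theta i) (theta j) = 0.
  move=> ij; rewrite -(rep_isometry rep_pi 0).
  have := orbit_comb_orth gen_theta [:: (1, 0)] [:: (1, 0)] ij.
  by rewrite /orbit_comb !big_seq1 !scale1r.
have [f finj] : exists f : H -> nat, {in D &, injective f}.
  by have /countable_injP[f ?] := cD; exists f.
apply/countable_injP; exists (f \o g) => i j; rewrite !inE => si sj /= fg.
have [Dgi gi] := gP i si; have [Dgj gj] := gP j sj.
have gij : g i = g j by apply: finj; rewrite ?inE.
apply/eqP; apply/negPn/negP => ij.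
have : nsq (theta i - theta j) = nsq (theta i) + nsq (theta j).
  by rewrite (nsqB ip_norm) orth //= mulr0 subr0.
have := nsqD_le ip_norm (theta i - g i) (g i - theta j).
rewrite addrA subrK -[g i - theta j]opprB nsqN gij.
rewrite gij in gi.
by have := nsq_ge0 (theta i); have := nsq_ge0 (theta j); lra.
Qed.

(** All vanishing generators share the same bracket representative, so the
    exceptional null set does not depend on which of them is considered. *)
Lemma ae_gram_eq0 : {ae muhat, forall a i, ~ nonzero_generators i -> gramT i a = 0}.
Proof.
have h0 : is_bracket 0 0 (bracket ip pi muhat 0 0) by exact: bracketP.
have [[i1 _] _] := h0.
have le : {ae muhat, forall a, 0 <= - complex.Re (bracket ip pi muhat 0 0 a)}.
  have i1' : rint (fun a => - complex.Re (bracket ip pi muhat 0 0 a)).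
    by under [X in EFin \o X]eq_fun do rewrite -mulN1r; exact: rintZ.
  apply: (ae_ge0_of_tests (trig_algebra R G)
    (trig_dense second_countableG discreteG (mu := muhat)) i1') => _ [s _ <-].
  have e := nsq_comb ip_norm rep_pi s h0.
  have z : orbit_comb pi (0 : H) s = 0.
    by rewrite /orbit_comb big1 // => k _; rewrite linear0 scaler0.
  rewrite z nsq0 in e.
  have [C sC] := @cbounded_trig R G s.
  have -> : Rintegral muhat setT (fun a =>
      sqmod (trig s a) * - complex.Re (bracket ip pi muhat 0 0 a)) =
      - Rintegral muhat setT (fun a =>
      sqmod (trig s a) * complex.Re (bracket ip pi muhat 0 0 a)).
    rewrite -mulN1r -RintegralZl //; first by apply: eq_Rintegral => a _; ring.
    under [X in EFin \o X]eq_fun do rewrite mulrC.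
    apply: (rintM (C := C) i1 (measurable_sqmod (@cmeasurable_trig R G s))) => a.
    by rewrite ger0_norm // sqmod_ge0.
  by rewrite -e oppr0.
apply: filterS2 le (bracket_ge0 second_countableG discreteG ip_norm rep_pi h0).
move=> a le0 [tE ge0] i /negP; rewrite negbK => /eqP ti.
rewrite /gram ti tE; apply: complex_eq => //=; lra.
Qed.

Section Vector.
Variables (v : H) (b : I -> Ghat -> R[i]).
Hypothesis hb : forall i, is_bracket v (theta i) (b i).

(** When b i is the bracket of v with theta i this is T v (a).  Leaving b free
    allows the bracket of a finite combination to be the combination of the
    brackets pointwise, and not merely almost everywhere. *)
Definition fiber (a : Ghat) (i : I) : R[i] :=
  \1_(Omega ip pi muhat theta i) a * (b i a / sqrtC (gramT i a)).

Local Notation q i a := (component_density muhat ip pi theta b i a).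

Definition fiber_sqnorm (a : Ghat) : \bar R := \esum_(i in nonzero_generators) (q i a)%:E.

Lemma sqmod_sqrtC (r : R) : 0 <= r -> sqmod (sqrtC ((r%:C)%C : R[i])) = r.
Proof.
move=> r0; apply/eqP; rewrite -(eqrXn2 (n := 2)) ?sqmod_ge0 //.
by rewrite expr2 -sqmodM -expr2 sqrtCK sqmod_real.
Qed.

Lemma fiber_component i a : gramT i a = ((regramT i a)%:C)%C -> 0 <= regramT i a ->
  sqmod (fiber a i) = q i a.
Proof.
move=> ge h0; rewrite /fiber /component_density /quotient_density.
rewrite max_r; last by rewrite mulr_ge0 ?sqmod_ge0 // invr_ge0.
have [g0|gn0] := eqVneq (gramT i a) 0.
  have hz : regramT i a = 0 by rewrite /regram g0.
  rewrite indicE memNset; last by rewrite /Omega /= -/(gramT i a) g0 eqxx.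
  by rewrite mul0r sqmod0 hz invr0 mulr0.
rewrite indicE mem_set // mul1r sqmodM sqmodV ge sqmod_sqrtC //.
Qed.

Lemma ae_fiber_sqnorm : {ae muhat, forall a, l2_sqnorm (fiber a) = fiber_sqnorm a}.
Proof.
have real : {ae muhat, forall a i, nonzero_generators i ->
    gramT i a = ((regramT i a)%:C)%C /\ 0 <= regramT i a}.
  apply: ae_forall_countable countable_nonzero_generators _ => i _.
  exact: (gram_real second_countableG discreteG ip_norm rep_pi dual_pi).
apply: filterS2 real ae_gram_eq0 => a re z.
rewrite /l2_sqnorm /fiber_sqnorm [RHS]esum_mkcond; apply: eq_esum => i _.
case: (boolP (i \in nonzero_generators)).
  by rewrite inE => /re [ge h0]; rewrite fiber_component.
rewrite notin_setE => /z gz.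
by rewrite /fiber indicE memNset ?mul0r ?sqmod0 // /Omega /= -/(gramT i a) gz eqxx.
Qed.

Lemma component_density_ge0 i a : 0 <= q i a.
Proof. by rewrite le_max lexx. Qed.

Lemma measurable_component_density i : measurable_fun setT (fun a => q i a).
Proof.
apply: measurable_maxr; first exact: measurable_cst.
by apply: measurable_quotient_density; [exact: (hb i).1|exact: rint_regram].
Qed.

Lemma fiber_sqnorm_ge0 a : (0 <= fiber_sqnorm a)%E.
Proof. by apply: esum_ge0 => i _; rewrite lee_fin component_density_ge0. Qed.

Lemma measurable_fiber_sqnorm : measurable_fun setT fiber_sqnorm.
Proof.
by have [] := esum_countable_integral muhat countable_nonzero_generators
  measurable_component_density component_density_ge0.
Qed.

(** The map T is isometric: by Parseval's identity, after exchanging the integral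
    with the sum over the countably many nonzero generators. *)
Lemma integral_fiber_sqnorm : (\int[muhat]_a fiber_sqnorm a = (nsq v)%:E)%E.
Proof.
have [_ ->] := esum_countable_integral muhat countable_nonzero_generators
  measurable_component_density component_density_ge0.
rewrite (parseval second_countableG discreteG ip_norm rep_pi dual_pi gen_theta hb).
rewrite esum_mkcond; apply: eq_esum => i _.
case: (boolP (i \in nonzero_generators)) => //; rewrite notin_setE => si.
symmetry; transitivity (\int[muhat]_a (cst 0%E a))%E; last by rewrite integral0.
apply: ge0_ae_eq_integral => //.
- by apply/measurable_EFinP; exact: measurable_component_density.
- by move=> a _; rewrite lee_fin component_density_ge0.
apply: filterS ae_gram_eq0 => a z _ /=.
rewrite /component_density /quotient_density /regram z //= invr0 mulr0.
by rewrite maxxx.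
Qed.

End Vector.

End Fibers.

(** * Riesz inequalities for orbits and for fibers *)

Section RieszOrbits.
Variables (R : realType) (G : topologicalZmodType).
Hypothesis second_countableG : @second_countable G.
Hypothesis discreteG : forall U : set G, open U.
Variables (mu : {measure set (borel G) -> \bar R})
          (muhat : {measure set (borel (dual R G)) -> \bar R}).
Hypothesis haar_mu : is_haar mu.
Hypothesis counting_mu : mu [set (0 : G)] = 1%E.
Hypothesis dual_muhat : dual_measure mu muhat.
Variable (H : completeNormedModType R[i]).
Variable ip : {dot H for @Num.conj R[i]}.
Hypothesis ip_norm : forall v : H, `|v| ^+ 2 = ip v v.
Hypothesis separableH : exists2 D : set H, countable D & dense D.
Variable pi : G -> {linear H -> H}.
Hypothesis rep_pi : unitary_rep ip pi.
Hypothesis dual_pi : dual_integrable ip pi muhat.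
Variables (I : choiceType) (theta : I -> H).
Hypothesis gen_theta : orthogonal_generators ip pi theta.
Variables (J : countType) (phi : J -> H) (A B : R).
Hypotheses (A_gt0 : 0 < A) (leAB : A <= B).
Local Notation Ghat := (borel (dual R G)).
Local Notation rint f := (muhat.-integrable setT (EFin \o f)).
Local Notation is_bracket := (is_bracket ip pi muhat).
Local Notation br j i := (bracket ip pi muhat (phi j) (theta i)).
Local Notation fiberT := (fiber muhat ip pi theta).
Local Notation Tphi j a := (T_map ip pi muhat theta (phi j) a).

Let Plancherel xs c := @trig_parseval R G discreteG mu muhat haar_mu counting_mu dual_muhat xs c.
Let isometry := integral_fiber_sqnorm second_countableG discreteG ip_norm separableH
  rep_pi dual_pi gen_theta.
Let ae_fiber := ae_fiber_sqnorm second_countableG discreteG ip_norm separableH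
  rep_pi dual_pi gen_theta.
Let measurable_S := measurable_fiber_sqnorm ip_norm separableH
  rep_pi dual_pi gen_theta.

Lemma brP j i : is_bracket (phi j) (theta i) (br j i).
Proof. exact: bracketP. Qed.

Lemma fiber_sum (K : Type) (s : seq K) (m : K -> R[i]) (bk : K -> I -> Ghat -> R[i])
    (b : I -> Ghat -> R[i]) (a : Ghat) :
  (forall i, b i a = \sum_(k <- s) m k * bk k i a) ->
  fiberT b a = \sum_(k <- s) m k *: fiberT (bk k) a.
Proof.
move=> bE; apply/funext => i; rewrite fct_sumE /fiber bE.
rewrite mulr_suml mulr_sumr; apply: eq_bigr => k _.
by rewrite -!mulrA mulrCA.
Qed.

(** The fiber of a combination of the orbits is the combination of the fibers of
    the phi j whose coefficients are trigonometric polynomials; integrate the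
    pointwise inequalities and use Plancherel's identity on the coefficients. *)
Lemma riesz_orbit_of_fibers :
  {ae muhat, forall a, riesz_sequence (@l2_sqnorm R I) (fun j => Tphi j a) A B} ->
  forall (s : seq (G * J)) (c : G * J -> R[i]), uniq s ->
    ((A * \sum_(k <- s) sqmod (c k))%R%:E <=
       sqnorm (\sum_(k <- s) c k *: orbit_family pi phi k)%R
       <= (B * \sum_(k <- s) sqmod (c k))%R%:E)%E.
Proof.
move=> aeR s c us.
pose v := \sum_(k <- s) c k *: orbit_family pi phi k; rewrite -/v.
pose b i a := \sum_(k <- s) c k * (ev k.1 a * br k.2 i a).
have hb i : is_bracket v (theta i) (b i).
  apply: (is_bracket_sum s) => k; apply: is_bracketZ.
  exact: (is_bracket_pi rep_pi k.1 (brP k.2 i)).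
pose js := undup (map snd s).
pose m j (a : Ghat) := \sum_(k <- s | k.2 == j) c k * ev k.1 a.
have fE a : fiberT b a = \sum_(j <- js) m j a *: Tphi j a.
  apply: (fiber_sum (m := fun j => m j a) (bk := fun j i => br j i)) => i.
  rewrite /b (big_group s snd); apply: eq_bigr => j _.
  by rewrite /m mulr_suml; apply: eq_bigr => k /eqP ->; rewrite mulrA.
pose xs j := [seq k.1 | k <- s & k.2 == j].
have uxs j : uniq (xs j).
  rewrite map_inj_in_uniq ?filter_uniq // => -[x1 j1] [x2 j2].
  by rewrite !mem_filter /= => /andP[/eqP -> _] /andP[/eqP -> _] ->.
have mE j a : m j a = \sum_(x <- xs j) c (x, j) * ev x a.
  by rewrite /xs big_map big_filter; apply: eq_bigr => -[x j'] /= /eqP ->.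
have mm j : measurable_fun setT (fun a => sqmod (m j a)).
  apply: measurable_sqmod; rewrite (_ : m j = fun a => \sum_(x <- xs j) c (x, j) * ev x a); last first.
    by apply/funext => a; exact: mE.
  apply: cmeasurable_sum => x; apply: cmeasurableM; first exact: cmeasurable_cst.
  exact: cmeasurable_ev.
have mS : measurable_fun setT (fun a => (\sum_(j <- js) (sqmod (m j a))%:E)%E).
  by apply: emeasurable_sum => j; apply/measurable_EFinP.
have intm (K : R) : 0 <= K -> (\int[muhat]_a (K * \sum_(j <- js) sqmod (m j a))%:E =
    (K * \sum_(k <- s) sqmod (c k))%:E)%E.
  move=> K0; under eq_integral do rewrite EFinM -sumEFin.
  rewrite ge0_integralZl //; last by move=> a _; apply: sume_ge0 => j _; rewrite lee_fin sqmod_ge0.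
  rewrite ge0_integral_sum //; last first.
  - by move=> j a _; rewrite lee_fin sqmod_ge0.
  - by move=> j; apply/measurable_EFinP.
  rewrite EFinM; congr (_ * _)%E; rewrite (big_group s snd) -sumEFin.
  apply: eq_bigr => j _; under eq_integral do rewrite mE.
  rewrite Plancherel // /xs big_map big_filter; congr EFin.
  by apply: eq_bigr => -[x j'] /= /eqP ->.
have mK (K : R) : measurable_fun setT (fun a => (K * \sum_(j <- js) sqmod (m j a))%:E).
  by under eq_fun do rewrite EFinM -sumEFin; exact: measurable_funeM.
have K0 (K : R) a : 0 <= K -> (0 <= (K * \sum_(j <- js) sqmod (m j a))%:E)%E.
  by move=> ?; rewrite lee_fin mulr_ge0 //; apply: sumr_ge0 => j _; exact: sqmod_ge0.
have B_ge0 : 0 <= B by apply: le_trans leAB; exact: ltW.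
have A_ge0 : 0 <= A by exact: ltW.
have bounds : {ae muhat, forall a,
    ((A * \sum_(j <- js) sqmod (m j a))%:E <= fiber_sqnorm muhat ip pi theta b a <=
     (B * \sum_(j <- js) sqmod (m j a))%:E)%E}.
  apply: filterS2 aeR (ae_fiber b) => a /riesz_sequence_finite[_ rz] <-.
  by rewrite fE; apply: rz; exact: undup_uniq.
rewrite -!intm // sqnormE -(isometry hb); apply/andP; split.
  apply: ae_ge0_le_integral => //.
  - by move=> a _; exact: K0.
  - by move=> a _; exact: fiber_sqnorm_ge0.
  - exact: measurable_S.
  - by apply: filterS bounds => a /andP[].
apply: ae_ge0_le_integral => //.
- by move=> a _; exact: fiber_sqnorm_ge0.
- exact: measurable_S.
- by move=> a _; exact: K0.
- by apply: filterS bounds => a /andP[].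
Qed.

Lemma rint_cst (k : R) : 0 <= k -> rint (fun=> k).
Proof.
move=> k0; apply/(rint_ge0P muhat (f := fun=> k)) => //.
rewrite integral_cst // (muhat_total discreteG haar_mu counting_mu dual_muhat).
by rewrite mule1 ltry.
Qed.

Section Localization.
Hypothesis riesz_orbit : forall (s : seq (G * J)) (c : G * J -> R[i]), uniq s ->
    ((A * \sum_(k <- s) sqmod (c k))%R%:E <=
       sqnorm (\sum_(k <- s) c k *: orbit_family pi phi k)%R
       <= (B * \sum_(k <- s) sqmod (c k))%R%:E)%E.

Variables (js : seq J) (d : J -> R[i]).
Hypothesis ujs : uniq js.

Let D2 := \sum_(j <- js) sqmod (d j).
Let b i a := \sum_(j <- js) d j * br j i a.

Let hb i : is_bracket (\sum_(j <- js) d j *: phi j) (theta i) (b i).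
Proof. by apply: (is_bracket_sum js) => j; apply: is_bracketZ; exact: brP. Qed.

Let S := fiber_sqnorm muhat ip pi theta b.
Let g a := fine (S a).

Let S_ge0 a : (0 <= S a)%E.
Proof. exact: fiber_sqnorm_ge0. Qed.

Let g_ge0 a : 0 <= g a.
Proof. exact/fine_ge0/S_ge0. Qed.

Let mS : measurable_fun setT S.
Proof. exact: (measurable_S hb). Qed.

Let mg : measurable_fun setT g.
Proof. by have := @measurableT_comp _ _ _ _ _ _ fine _ S _ mS; apply. Qed.

Let ae_S : {ae muhat, forall a, S a = (g a)%:E}.
Proof.
have iS : muhat.-integrable setT S.
  apply/integrableP; split => //.
  by under eq_integral do rewrite gee0_abs //; rewrite (isometry hb) ltry.
by have := integrable_ae measurableT iS; apply: filterS => a /(_ Logic.I) /fineK.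
Qed.

Let ig : rint g.
Proof.
apply/rint_ge0P => //.
rewrite -(ge0_ae_eq_integral measurableT mS) // ?(isometry hb) ?ltry //.
- exact/measurable_EFinP.
- by move=> a _; rewrite lee_fin g_ge0.
- by apply: filterS ae_S => a e _; rewrite e.
Qed.

Let nsq_modulated t :
  nsq (\sum_(j <- js) d j *: orbit_comb pi (phi j) t) =
  Rintegral muhat setT (fun a => sqmod (trig t a) * g a).
Proof.
pose b' i a := \sum_(j <- js) d j * (trig t a * br j i a).
have hb' i : is_bracket (\sum_(j <- js) d j *: orbit_comb pi (phi j) t) (theta i) (b' i).
  apply: (is_bracket_sum js) => j; apply: is_bracketZ.
  exact: (is_bracket_comb rep_pi t (brP j i)).
have fE a : fiberT b' a = trig t a *: fiberT b a.
  rewrite (fiber_sum (s := [:: tt]) (m := fun=> trig t a) (bk := fun=> b)) ?big_seq1 // => i.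
  by rewrite big_seq1 /b' /b mulr_sumr; apply: eq_bigr => j _; rewrite mulrCA.
have [C tC] := @cbounded_trig R G t.
have mt := measurable_sqmod (@cmeasurable_trig R G t).
have it : rint (fun a => sqmod (trig t a) * g a).
  under [X in EFin \o X]eq_fun do rewrite mulrC.
  by apply: (rintM (C := C) ig mt) => a; rewrite ger0_norm // sqmod_ge0.
apply: EFin_inj; rewrite -rint_intE // -(isometry hb').
apply: ge0_ae_eq_integral => //.
- exact: (measurable_S hb').
- by apply/measurable_EFinP; exact: measurable_funM.
- by move=> a _; exact: fiber_sqnorm_ge0.
- by move=> a _; rewrite lee_fin mulr_ge0 ?sqmod_ge0.
apply: filterS3 (ae_fiber b') (ae_fiber b) ae_S => a e1 e2 e3 _.
by rewrite -e1 fE l2_sqnormZ e2 -/S e3.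
Qed.

Let riesz_modulated t :
  A * D2 * Rintegral muhat setT (fun a => sqmod (trig t a)) <=
    Rintegral muhat setT (fun a => sqmod (trig t a) * g a) <=
  B * D2 * Rintegral muhat setT (fun a => sqmod (trig t a)).
Proof.
pose xs := undup (map snd t).
pose p x := \sum_(k <- t | k.2 == x) k.1.
have uxs : uniq xs by exact: undup_uniq.
have trigE a : trig t a = \sum_(x <- xs) p x * ev x a.
  rewrite /trig (big_group t snd); apply: eq_bigr => x _.
  by rewrite /p mulr_suml; apply: eq_bigr => k /eqP ->.
have combE u : orbit_comb pi u t = \sum_(x <- xs) p x *: pi x u.
  rewrite /orbit_comb (big_group t snd); apply: eq_bigr => x _.
  by rewrite /p scaler_suml; apply: eq_bigr => k /eqP ->.
have -> : Rintegral muhat setT (fun a => sqmod (trig t a)) = \sum_(x <- xs) sqmod (p x).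
  rewrite /Rintegral; under eq_integral do rewrite trigE.
  by rewrite Plancherel.
rewrite -nsq_modulated.
pose s := [seq (x, j) | x <- xs, j <- js].
pose c (k : G * J) := p k.1 * d k.2.
have us : uniq s by apply: allpairs_uniq => // -[? ?] [? ?] _ _ [-> ->].
have := riesz_orbit c us.
have -> : \sum_(k <- s) sqmod (c k) = D2 * \sum_(x <- xs) sqmod (p x).
  rewrite /s big_allpairs_dep mulrC mulr_suml; apply: eq_bigr => x _.
  by rewrite mulr_sumr; apply: eq_bigr => j _; rewrite /c /= sqmodM.
have -> : \sum_(k <- s) c k *: orbit_family pi phi k =
    \sum_(j <- js) d j *: orbit_comb pi (phi j) t.
  rewrite /s big_allpairs_dep exchange_big; apply: eq_bigr => j _.
  rewrite combE scaler_sumr; apply: eq_bigr => x _.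
  by rewrite /c /orbit_family /= scalerA mulrC.
by rewrite sqnormE !lee_fin !mulrA.
Qed.

(** Testing the Riesz inequalities of the orbits on all modulations of a fixed
    coefficient vector turns them into pointwise inequalities in the fibers. *)
Lemma ae_riesz_fiber : {ae muhat, forall a,
  l2_finite (\sum_(j <- js) d j *: Tphi j a) /\
  A * D2 <= l2_norm2 (\sum_(j <- js) d j *: Tphi j a) <= B * D2}.
Proof.
have B_gt0 : 0 < B by exact: lt_le_trans leAB.
have D20 : 0 <= D2 by apply: sumr_ge0 => j _; exact: sqmod_ge0.
have it t : rint (fun a => sqmod (trig t a)).
  have [C tC] := @cbounded_trig R G t.
  have mt := measurable_sqmod (@cmeasurable_trig R G t).
  have := rintM (C := C) (rint_cst ler01) mt.
  under [X in EFin \o X]eq_fun do rewrite mul1r.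
  by apply=> a; rewrite ger0_norm // sqmod_ge0.
have itg t : rint (fun a => sqmod (trig t a) * g a).
  have [C tC] := @cbounded_trig R G t.
  have mt := measurable_sqmod (@cmeasurable_trig R G t).
  under [X in EFin \o X]eq_fun do rewrite mulrC.
  by apply: (rintM (C := C) ig mt) => a; rewrite ger0_norm // sqmod_ge0.
have dense := trig_dense second_countableG discreteG (mu := muhat).
have low : {ae muhat, forall a, 0 <= g a - A * D2}.
  apply: (ae_ge0_of_tests (trig_algebra R G) dense) => [|_ [t _ <-]].
    by apply: rintB => //; apply: rint_cst; rewrite mulr_ge0 // ltW.
  under eq_Rintegral do rewrite mulrBr [_ * (A * D2)]mulrC.
  rewrite RintegralB // ?RintegralZl // ?subr_ge0; last exact: rintZ.
  by case/andP: (riesz_modulated t).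
have high : {ae muhat, forall a, 0 <= B * D2 - g a}.
  apply: (ae_ge0_of_tests (trig_algebra R G) dense) => [|_ [t _ <-]].
    by apply: rintB => //; apply: rint_cst; rewrite mulr_ge0 // ltW.
  under eq_Rintegral do rewrite mulrBr [_ * (B * D2)]mulrC.
  rewrite RintegralB // ?RintegralZl // ?subr_ge0; last exact: rintZ.
  by case/andP: (riesz_modulated t).
have both : {ae muhat, forall a, 0 <= g a - A * D2 /\ 0 <= B * D2 - g a}.
  by apply: filterS2 low high.
apply: filterS3 both (ae_fiber b) ae_S => a [l h] e1 e2.
have fE : fiberT b a = \sum_(j <- js) d j *: Tphi j a by exact: (fiber_sum (m := d) (bk := fun j i => br j i)).
have e : l2_sqnorm (\sum_(j <- js) d j *: Tphi j a) = (g a)%:E.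
  by rewrite -fE e1 -/S e2.
rewrite /l2_finite /l2_norm2 e ltry /=; split => //.
by apply/andP; split; rewrite -subr_ge0.
Qed.

End Localization.

(** Finitely supported rational coefficient vectors form a countable family, so
    one null set serves them all; continuity reaches the other vectors. *)
Lemma riesz_fibers_of_orbit :
  (forall (s : seq (G * J)) (c : G * J -> R[i]), uniq s ->
    ((A * \sum_(k <- s) sqmod (c k))%R%:E <=
       sqnorm (\sum_(k <- s) c k *: orbit_family pi phi k)%R
       <= (B * \sum_(k <- s) sqmod (c k))%R%:E)%E) ->
  {ae muhat, forall a, riesz_sequence (@l2_sqnorm R I) (fun j => Tphi j a) A B}.
Proof.
move=> rz.
have fin : {ae muhat, forall a j, setT j -> l2_finite (Tphi j a)}.
  apply: ae_forall_countable => [|j _]; first exact: countableP.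
  have := ae_riesz_fiber rz (fun=> 1) (js := [:: j]) isT; apply: filterS => a [].
  by rewrite big_seq1 scale1r.
have rat_ : {ae muhat, forall a (k : seq J * seq (rat * rat)), uniq k.1 ->
    let d := rational_coef R k.1 k.2 in
    A * \sum_(j <- k.1) sqmod (d j) <= l2_norm2 (\sum_(j <- k.1) d j *: Tphi j a)
      <= B * \sum_(j <- k.1) sqmod (d j)}.
  have := @ae_forall_countable _ _ _ muhat _ [set k : seq J * seq (rat * rat) | uniq k.1]
    (fun k a => let d := rational_coef R k.1 k.2 in
    A * \sum_(j <- k.1) sqmod (d j) <= l2_norm2 (\sum_(j <- k.1) d j *: Tphi j a)
      <= B * \sum_(j <- k.1) sqmod (d j)).
  apply; first exact: countableP.
  move=> [js r] /= ujs.
  by have := ae_riesz_fiber rz (rational_coef R js r) ujs; apply: filterS => a [].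
apply: filterS2 fin rat_ => a fa ra.
have fin_u j : l2_finite (Tphi j a) by exact: fa.
apply/riesz_sequence_finite; split; first exact: fin_u.
move=> s c us; have [f _] := l2_norm2_sum s c fin_u.
rewrite (l2_finiteE f) !lee_fin.
apply: (riesz_of_rational A_gt0 leAB fin_u) => r.
exact: (ra (s, r) us).
Qed.

End RieszOrbits.

Lemma lspan_self (K : numFieldType) (V : normedModType K) (X : set V) : X `<=` lspan X.
Proof.
move=> v Xv; exists 1%N, (fun=> 1), (fun=> v); split => //.
by rewrite big_ord1 scale1r.
Qed.

Unset Implicit Arguments.

Theorem theorem6p8 (R : realType)
  (* the second countable locally compact abelian group, written additively *)
  (G : topologicalZmodType)
  (hausdorffG : hausdorff_space G)
  (locally_compactG : locally_compact [set: G])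
  (second_countableG : @second_countable G)
  (mu : {measure set (borel G) -> \bar R})
  (haar_mu : is_haar mu)
  (muhat : {measure set (borel (dual R G)) -> \bar R})
  (haar_muhat : is_haar muhat)
  (dual_muhat : dual_measure mu muhat)
  (* the separable Hilbert space *)
  (H : completeNormedModType R[i])
  (ip : {dot H for @Num.conj R[i]})
  (ip_norm : forall v : H, `|v| ^+ 2 = ip v v)
  (separableH : exists2 D : set H, countable D & dense D)
  (pi : G -> {linear H -> H})
  (rep_pi : unitary_rep ip pi)
  (dual_pi : dual_integrable ip pi muhat)
  (I : choiceType) (theta : I -> H)
  (gen_theta : orthogonal_generators ip pi theta)
  (discreteG : forall U : set G, open U)
  (* the Haar measure of a discrete group is the counting measure *)
  (counting_mu : mu [set (0 : G)] = 1%E)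
  (J : countType) (phi : J -> H)
  (A B : R) (A_gt0 : 0 < A) (leAB : A <= B) :
  riesz_basis (invariant_span pi phi) (orbit_family pi phi) A B
  <->
  {ae muhat, forall a : borel (dual R G),
     riesz_sequence (@l2_sqnorm R I)
       (fun j : J => T_map ip pi muhat theta (phi j) a) A B}.
Proof.
split=> [[_ /riesz_sequence_finite[_ rz] _]|ae_rz].
  exact: (riesz_fibers_of_orbit second_countableG discreteG haar_mu counting_mu
    dual_muhat ip_norm separableH rep_pi dual_pi gen_theta A_gt0 leAB rz).
split => [k||//].
  by apply/subset_closure/lspan_self; exists k.
apply/riesz_sequence_finite; split; first by move=> k; rewrite sqnormE ltry.
exact: (riesz_orbit_of_fibers second_countableG discreteG haar_mu counting_mu
  dual_muhat ip_norm separableH rep_pi dual_pi gen_theta A_gt0 leAB ae_rz).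
Qed.
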